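(* Let $C$ be the germ at $0\in\mathbb{C}^2$ of an irreducible analytic planar curve, with multiplicity $m$ at $0$ and Puiseux characteristics $e_0=m, e_1,\dots,e_M$ and $\beta_1,\dots,\beta_M$. Then the Briançon-Skoda number $\operatorname{bs}(C)$ of the local ring $\mathcal{O}_{C,0}$ is $$\operatorname{bs}(C)=\left\lceil \frac{1}{m}\left(1+\sum_{i=1}^{M}(e_{i-1}-e_i)\beta_i\right)\right\rceil .$$
   Context: $C$ is a (reduced) irreducible germ of an analytic curve at $0\in\mathbb{C}^2$, and $\mathcal{O}_{C,0}$ is its local ring of germs of (strongly) holomorphic functions, i.e. $\mathcal{O}_{\mathbb{C}^2,0}$ modulo the ideal of germs vanishing on $C$. Briançon-Skoda number: for an ideal $I$ of a commutative ring $R$, the integral closure is $\overline{I}=\{\phi\in R:\ \exists N\ge 1,\ b_j\in I^j\ (1\le j\le N)\text{ with }\phi^N+b_1\phi^{N-1}+\dots+b_N=0\}$. The number $\operatorname{bs}(R)$ is the smallest integer $k\ge 1$ such that $\overline{I^{k+l-1}}\subset I^l$ for every ideal $I\subset R$ and every integer $l\ge 1$ ($\operatorname{bs}(R)=\infty$ if there is no such $k$). One writes $\operatorname{bs}(C):=\operatorname{bs}(\mathcal{O}_{C,0})$. Puiseux characteristics: let $m$ be the multiplicity of $C$ at $0$. By Puiseux's theorem, in suitable holomorphic coordinates $(z,w)$ of $\mathbb{C}^2$ at $0$, $C$ is parametrized near $0$ by its normalization $\Pi:\Delta\to C$, $\Pi(t)=(t^m,g(t))$, where $\Delta\subset\mathbb{C}$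 is a neighbourhood of $0$ and $g(t)=\sum_{k\ge m}c_kt^k$ is holomorphic. Set $e_0=m$ and inductively $\beta_j=\min\{k\in\mathbb{N}:\ c_k\neq 0,\ e_{j-1}\nmid k\}$ and $e_j=\gcd(e_{j-1},\beta_j)$. The construction stops at the index $M$ for which $e_M=1$. (If $m=1$ then $M=0$ and the sum over $i$ is empty.) $\lceil x\rceil$ denotes the smallest integer $n$ with $n\ge x$. *)

(* Defs.v *)
From HB Require Import structures.
From mathcomp Require Import all_boot all_order all_algebra.
From mathcomp Require Import all_classical all_reals all_analysis.
From mathcomp Require Import complex ring_quotient.

Set Implicit Arguments.
Unset Strict Implicit.
Unset Printing Implicit Defensive.

Import Order.TTheory GRing.Theory Num.Theory numFieldNormedType.Exports.
Local Open Scope classical_set_scope.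
Local Open Scope ring_scope.

Section BrianconSkoda.
Variable A : comNzRingType.
Implicit Types I : set A.

Definition is_ideal I : Prop :=
  [/\ I 0, forall x y, I x -> I y -> I (x + y) & forall a x, I x -> I (a * x)].

(* The coefficients [c i] only matter for [l = 0], where they give the unit
   ideal. *)
Definition ideal_pow I (l : nat) : set A :=
  [set x | exists (n : nat) (c : 'I_n -> A) (u : 'I_n -> 'I_l -> A),
     (forall i j, I (u i j)) /\ x = \sum_(i < n) c i * \prod_(j < l) u i j].

Definition integral_closure I : set A :=
  [set phi | exists (N : nat) (b : nat -> A),
     [/\ (1 <= N)%N,
         forall j, (1 <= j <= N)%N -> ideal_pow I j (b j)
       & phi ^+ N + \sum_(1 <= j < N.+1) b j * phi ^+ (N - j) = 0]].

Definition bs_property (k : nat) : Prop :=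
  (1 <= k)%N /\
  forall I, is_ideal I -> forall l : nat, (1 <= l)%N ->
    integral_closure (ideal_pow I (k + l - 1)) `<=` ideal_pow I l.

Definition bs : \bar int :=
  if pselect (exists k, `[< bs_property k >]) is left ex_k
  then ((ex_minn ex_k)%:Z)%:E else +oo%E.

End BrianconSkoda.

(* Keeping the numClosedFieldType packed gives C and C * C the topology that
   the library attaches to every numFieldType. *)
Definition CC (R : realType) : numClosedFieldType := R[i]%C.

Section HolomorphicFunctions.
Variable R : realType.
Local Notation C := (CC R).
Implicit Types (f g : C * C -> C) (a b : nat -> nat -> C) (p : C * C).

Definition pser2 a p (n : nat) : C :=
  \sum_(i < n) \sum_(j < n) a i j * p.1 ^+ i * p.2 ^+ j.

(* [f] is the sum of the power series with coefficients [a] on a polydisc.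
   By Abel's lemma the bound on the coefficients is absolute convergence in the
   polydisc of radius [r], so the choice of square partial sums is harmless. *)
Definition has_expansion a f : Prop :=
  exists r B : C,
    [/\ 0 < r,
        forall i j, `|a i j| * r ^+ (i + j) <= B
      & forall p, `|p.1| < r -> `|p.2| < r -> pser2 a p @ \oo --> f p].

Definition holomorphic_at0 : {pred C * C -> C} :=
  fun f => `[< exists a, has_expansion a f >].

Lemma has_expansion_shrink a (r' r B : C) : 0 < r' -> r' <= r ->
  (forall i j, `|a i j| * r ^+ (i + j) <= B) ->
  forall i j, `|a i j| * r' ^+ (i + j) <= B.
Proof.
move=> r'0 rr' H i j; apply: (le_trans _ (H i j)).
have r0 : 0 <= r by rewrite (le_trans (ltW r'0)).
by apply: ler_wpM2l => //; apply: lerXn2r; rewrite // nnegrE ltW.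
Qed.

Lemma has_expansion2 a b f g : has_expansion a f -> has_expansion b g ->
  exists r B : C, [/\ 0 < r, 0 <= B,
    forall i j, `|a i j| * r ^+ (i + j) <= B,
    forall i j, `|b i j| * r ^+ (i + j) <= B
  & forall p, `|p.1| < r -> `|p.2| < r ->
      pser2 a p @ \oo --> f p /\ pser2 b p @ \oo --> g p].
Proof.
move=> [r [B [r0 Ha fa]]] [s [D [s0 Hb gb]]].
have B0 : 0 <= B := le_trans (mulr_ge0 (normr_ge0 _) (exprn_ge0 _ (ltW r0))) (Ha 0%N 0%N).
have D0 : 0 <= D := le_trans (mulr_ge0 (normr_ge0 _) (exprn_ge0 _ (ltW s0))) (Hb 0%N 0%N).
have [t [t0 tr ts]] : exists t : C, [/\ 0 < t, t <= r & t <= s].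
  case: (real_leP (gtr0_real r0) (gtr0_real s0)) => h; first by exists r.
  by exists s; split => //; apply: ltW.
exists t, (B + D); split => //.
- exact: addr_ge0.
- by move=> i j; apply: (le_trans (has_expansion_shrink t0 tr Ha i j)); rewrite lerDl.
- by move=> i j; apply: (le_trans (has_expansion_shrink t0 ts Hb i j)); rewrite lerDr.
- by move=> p p1 p2; split; [apply: fa|apply: gb]; apply: lt_le_trans; eassumption.
Qed.

Lemma holomorphic_at0_1 : 1 \in holomorphic_at0.
Proof.
apply/asboolP; exists (fun i j => ((i == 0%N) && (j == 0%N))%:R), 1, 1; split => //.
  by move=> i j; rewrite expr1n mulr1; case: (_ && _); rewrite ?normr1 ?normr0.
move=> p _ _; apply: (@cvg_near_cst _ _ (1 : C)).
near=> n.
have n0 : (0 < n)%N by near: n; exists 1%N.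
rewrite /pser2 -(prednK n0) big_ord_recl big_ord_recl /= !mul1r expr0 mulr1.
rewrite big1 ?addr0 => [|j _]; last by rewrite !mul0r.
by rewrite big1 ?addr0 // => i _; rewrite big1 // => j _; rewrite !mul0r.
Unshelve. all: by end_near. Qed.

Lemma holomorphic_at0B f g : f \in holomorphic_at0 -> g \in holomorphic_at0 ->
  f - g \in holomorphic_at0.
Proof.
move=> /asboolP[a Ha] /asboolP[b Hb]; apply/asboolP.
have [r [B [r0 B0 aB bB cv]]] := has_expansion2 Ha Hb.
exists (fun i j => a i j - b i j), r, (B + B); split => //.
  move=> i j; apply: le_trans (_ : (`|a i j| + `|b i j|) * r ^+ (i + j) <= _).
    by apply: ler_wpM2r; [rewrite exprn_ge0 ?ltW|apply: ler_normB].
  by rewrite mulrDl lerD.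
move=> p p1 p2; have [fa gb] := cv p p1 p2.
have -> : pser2 (fun i j => a i j - b i j) p = pser2 a p - pser2 b p.
  apply/funext => n; rewrite !fctE /pser2 -sumrB; apply: eq_bigr => i _.
  by rewrite -sumrB; apply: eq_bigr => j _; rewrite !mulrBl.
have -> : (f - g) p = f p - g p by [].
have /= := cvgB fa gb; apply.
Qed.

Lemma CC_archi (x : C) : 0 <= x -> exists n, x < n%:R.
Proof.
case: x => x y; rewrite lecE /= => /andP[/eqP -> x0].
exists (Num.bound x); have := archi_boundP x0.
by rewrite -(rmorph_nat (@real_complex R)) ltcR.
Qed.

Lemma CC_cvg0 (u : nat -> C) (B : C) : 0 <= B ->
  (forall n, `|u n| <= B / n.+1%:R) -> u @ \oo --> (0 : C).
Proof.
move=> B0 H; apply/cvgrPdist_lt => e e0.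
have [N HN] := CC_archi (divr_ge0 B0 (ltW e0)).
exists N => // n /= Nn; rewrite sub0r normrN; apply: le_lt_trans (H n) _.
rewrite ltr_pdivrMr ?ltr0n // mulrC -ltr_pdivrMr //.
by apply: lt_trans HN _; rewrite ltr_nat ltnS.
Qed.

Definition cauchy2 a b (i j : nat) : C :=
  \sum_(k < i.+1) \sum_(l < j.+1) a k l * b (i - k)%N (j - l)%N.

Lemma sum_antidiag (V : nmodType) (F : nat -> nat -> V) n :
  \sum_(i < n) \sum_(k < i.+1) F k (i - k)%N =
  \sum_(k < n) \sum_(k' < n | (k + k' < n)%N) F k k'.
Proof.
have -> : \sum_(i < n) \sum_(k < i.+1) F k (i - k)%N =
    \sum_(i < n) \sum_(k < n | (k <= i)%N) F k (i - k)%N.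
  by apply: eq_bigr => i _; rewrite (big_ord_widen n (fun k => F k (i - k)%N)).
rewrite (exchange_big_dep xpredT) //=; apply: eq_bigr => k _.
have -> : \sum_(k' < n | (k + k' < n)%N) F k k' = \sum_(0 <= k' < n - k) F k k'.
  rewrite big_mkord (big_ord_widen n (fun j => F k j)) ?leq_subr //.
  by apply: eq_bigl => j; rewrite ltn_subRL.
transitivity (\sum_(k <= i < n) F k (i - k)%N).
  rewrite [RHS](big_nat_widenl _ 0%N) // big_mkord.
  by apply: eq_bigl => i; rewrite andTb.
rewrite -{1}[k : nat]add0n big_addn.
by apply: eq_bigr => i _; rewrite addnK.
Qed.

Lemma pser2_cauchy a b p n : pser2 (cauchy2 a b) p n =
  \sum_(k < n) \sum_(k' < n | (k + k' < n)%N)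
    \sum_(l < n) \sum_(l' < n | (l + l' < n)%N)
      (a k l * p.1 ^+ k * p.2 ^+ l) * (b k' l' * p.1 ^+ k' * p.2 ^+ l').
Proof.
set F := fun k k' l l' : nat =>
  (a k l * p.1 ^+ k * p.2 ^+ l) * (b k' l' * p.1 ^+ k' * p.2 ^+ l').
rewrite -(sum_antidiag (fun k k' =>
  \sum_(l < n) \sum_(l' < n | (l + l' < n)%N) F k k' l l')).
apply: eq_bigr => i _; 
under [RHS]eq_bigr => k _ do rewrite -(sum_antidiag (F k (i - k)%N)).
rewrite [RHS]exchange_big /=; apply: eq_bigr => j _.
rewrite /cauchy2 !mulr_suml; apply: eq_bigr => k _.
rewrite !mulr_suml; apply: eq_bigr => l _; rewrite /F.
have ki : (k <= i)%N by rewrite -ltnS.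
have lj : (l <= j)%N by rewrite -ltnS.
have -> : p.1 ^+ i = p.1 ^+ k * p.1 ^+ (i - k) by rewrite -exprD subnKC.
have -> : p.2 ^+ j = p.2 ^+ l * p.2 ^+ (j - l) by rewrite -exprD subnKC.
rewrite [RHS]mulrACA; congr (_ * _); exact: mulrACA.
Qed.

Lemma holomorphic_at0M f g : f \in holomorphic_at0 -> g \in holomorphic_at0 ->
  f * g \in holomorphic_at0.
Proof.
move=> /asboolP[a Ha] /asboolP[b Hb]; apply/asboolP.
have [r [B [r0 B0 aB bB cv]]] := has_expansion2 Ha Hb.
have BB0 : 0 <= B * B by apply: mulr_ge0.
pose q : C := 32%:R^-1.
have q0 : 0 < q by rewrite invr_gt0 ltr0n.
have q1 : q <= 1 by rewrite invf_le1 ?ltr0n // ler1n.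
have natq (m n : nat) : (m <= 32 ^ n)%N -> m%:R * q ^+ n <= 1 :> C.
  move=> mn; rewrite exprVn ler_pdivrMr ?exprn_gt0 ?ltr0n // mul1r.
  by rewrite -natrX ler_nat.
exists (cauchy2 a b), (r * q), (B * B); split; first exact: mulr_gt0.
  move=> i j; rewrite exprMn mulrA.
  have coefB : `|cauchy2 a b i j| * r ^+ (i + j) <= (i.+1 * j.+1)%:R * (B * B).
    apply: (@le_trans _ _ (\sum_(k < i.+1) \sum_(l < j.+1) B * B)); last first.
      by rewrite !sumr_const !card_ord -mulrnA mulr_natl mulnC.
    apply: (@le_trans _ _ (\sum_(k < i.+1) \sum_(l < j.+1)
        `|a k l * b (i - k)%N (j - l)%N| * r ^+ (i + j))).
      under eq_bigr => k _ do rewrite -mulr_suml.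
      rewrite -mulr_suml; apply: ler_wpM2r; first by rewrite exprn_ge0 ?ltW.
      apply: (le_trans (ler_norm_sum _ _ _)); apply: ler_sum => k _.
      exact: ler_norm_sum.
    apply: ler_sum => k _; apply: ler_sum => l _.
    have -> : r ^+ (i + j) = r ^+ (k + l) * r ^+ (i - k + (j - l)).
      have ki : (k <= i)%N by rewrite -ltnS.
      have lj : (l <= j)%N by rewrite -ltnS.
      by rewrite -exprD addnACA !subnKC.
    rewrite normrM mulrACA; apply: ler_pM; rewrite ?aB ?bB //.
      by apply: mulr_ge0 (normr_ge0 _) (exprn_ge0 _ (ltW r0)).
    by apply: mulr_ge0 (normr_ge0 _) (exprn_ge0 _ (ltW r0)).
  apply: (le_trans (ler_wpM2r (exprn_ge0 _ (ltW q0)) coefB)).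
  rewrite mulrAC -[leRHS]mul1r; apply: ler_wpM2r => //; apply: natq.
  by rewrite expnD leq_mul // ltn_expl.
have rqr : r * q <= r by rewrite ger_pMr.
move=> p p1 p2.
have [fa gb] := cv p (lt_le_trans p1 rqr) (lt_le_trans p2 rqr).
suff H : (fun n => pser2 a p n * pser2 b p n - pser2 (cauchy2 a b) p n)
    @ \oo --> (0 : C).
  have -> : pser2 (cauchy2 a b) p = (fun n => pser2 a p n * pser2 b p n -
      (pser2 a p n * pser2 b p n - pser2 (cauchy2 a b) p n)).
    by apply/funext => n; rewrite subKr.
  have -> : (f * g) p = f p * g p - 0 by rewrite subr0.
  have /= := cvgB (cvgM fa gb) H; apply.
apply: (CC_cvg0 BB0) => n.
have term (c : nat -> nat -> C) k l : (forall i j, `|c i j| * r ^+ (i + j) <= B) ->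
    `|c k l * p.1 ^+ k * p.2 ^+ l| <= B * q ^+ (k + l).
  move=> cB; apply: (@le_trans _ _ (`|c k l| * (r * q) ^+ (k + l))).
    rewrite -mulrA normrM; apply: ler_wpM2l => //.
    rewrite normrM !normrX exprD; apply: ler_pM; rewrite ?exprn_ge0 //.
      by apply: lerXn2r; rewrite ?nnegrE ?normr_ge0 ?ltW // mulr_gt0.
    by apply: lerXn2r; rewrite ?nnegrE ?normr_ge0 ?ltW // mulr_gt0.
  by rewrite exprMn mulrA; apply: ler_wpM2r (cB k l); rewrite exprn_ge0 ?ltW.
pose T k k' l l' :=
  (a k l * p.1 ^+ k * p.2 ^+ l) * (b k' l' * p.1 ^+ k' * p.2 ^+ l').
have -> : pser2 a p n * pser2 b p n - pser2 (cauchy2 a b) p n =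
    \sum_(k < n) \sum_(k' < n) \sum_(l < n) \sum_(l' < n)
      (if (k + k' < n)%N && (l + l' < n)%N then 0 else T k k' l l').
  rewrite pser2_cauchy {1}/pser2 mulr_suml -sumrB; apply: eq_bigr => k _.
  rewrite {1}/pser2 mulr_sumr [X in _ - X]big_mkcond -sumrB /=.
  apply: eq_bigr => k' _.
  have -> : (\sum_(l < n) a k l * p.1 ^+ k * p.2 ^+ l) *
      (\sum_(l' < n) b k' l' * p.1 ^+ k' * p.2 ^+ l') =
      \sum_(l < n) \sum_(l' < n) T k k' l l'.
    by rewrite mulr_suml; apply: eq_bigr => l _; rewrite mulr_sumr.
  case: ifP => _ /=; last by rewrite subr0.
  rewrite -sumrB; apply: eq_bigr => l _.
  rewrite [X in _ - X]big_mkcond -sumrB /=; apply: eq_bigr => l' _.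
  by case: ifP => _; rewrite ?subr0 // subrr.
apply: (@le_trans _ _ (\sum_(k < n) \sum_(k' < n) \sum_(l < n) \sum_(l' < n)
    (B * B) * q ^+ n)).
  apply: (le_trans (ler_norm_sum _ _ _)); apply: ler_sum => k _.
  apply: (le_trans (ler_norm_sum _ _ _)); apply: ler_sum => k' _.
  apply: (le_trans (ler_norm_sum _ _ _)); apply: ler_sum => l _.
  apply: (le_trans (ler_norm_sum _ _ _)); apply: ler_sum => l' _.
  case: ifPn => [_|]; first by rewrite normr0; exact: mulr_ge0 BB0 (exprn_ge0 _ (ltW q0)).
  rewrite negb_and -!leqNgt => nle.
  apply: (@le_trans _ _ ((B * q ^+ (k + l)) * (B * q ^+ (k' + l')))).
    by rewrite normrM; apply: ler_pM; rewrite ?normr_ge0 ?term.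
  rewrite mulrACA -exprD; apply: ler_wpM2l => //.
  apply: ler_wiXn2l; rewrite ?(ltW q0) //.
  by rewrite addnACA; case/orP: nle => h;
    rewrite (leq_trans h) // ?leq_addr ?leq_addl.
rewrite !sumr_const !card_ord -!mulrnA -[leLHS]mulr_natl mulrCA.
apply: ler_wpM2l => //.
rewrite -[leRHS]mul1r ler_pdivlMr ?ltr0n // mulrAC -natrM; apply: natq.
have n2 := ltn_expl n (isT : 1 < 2)%N; have n2' := ltnW n2.
by rewrite (_ : 32 = 2 * 2 * 2 * 2 * 2)%N // !expnMn !mulnA; do ?apply: leq_mul.
Qed.

Fact holomorphic_at0_subring : subring_closed holomorphic_at0.
Proof.
split; [exact: holomorphic_at0_1 | exact: holomorphic_at0B |
        exact: holomorphic_at0M].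
Qed.

HB.instance Definition _ := GRing.isSubringClosed.Build (C * C -> C)
  holomorphic_at0 holomorphic_at0_subring.

Record holo_fun := HoloFun {
  holo_val :> C * C -> C;
  _ : holo_val \in holomorphic_at0 }.

HB.instance Definition _ := [isSub for holo_val].
HB.instance Definition _ := [Choice of holo_fun by <:].
HB.instance Definition _ := [SubChoice_isSubComNzRing of holo_fun by <:].

Definition eq_germ (X Y : set (C * C)) : Prop :=
  \forall p \near (0 : C * C), X p <-> Y p.

Definition zero_set (f : C * C -> C) : set (C * C) := [set p | f p = 0].

Definition analytic_germ (X : set (C * C)) : Prop :=
  exists (n : nat) (f : 'I_n -> holo_fun),
    eq_germ X (\bigcap_i zero_set (f i)).

(* An analytic curve germ in the plane is a hypersurface germ: the zero set of
   one nonzero noninvertible germ of holomorphic function. *)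
Definition curve_germ (X : set (C * C)) : Prop :=
  exists f : holo_fun,
    [/\ f 0 = 0, ~ eq_germ (zero_set f) setT & eq_germ X (zero_set f)].

Definition irreducible_germ (X : set (C * C)) : Prop :=
  forall Y Z, analytic_germ Y -> analytic_germ Z -> eq_germ X (Y `|` Z) ->
    eq_germ X Y \/ eq_germ X Z.

Record plane_branch := PlaneBranch {
  branch_set : set (C * C);
  branch_curve : curve_germ branch_set;
  branch_irreducible : irreducible_germ branch_set }.

Lemma branch0 (X : plane_branch) : branch_set X 0.
Proof. by have [f [f0 _ /nbhs_singleton ->]] := branch_curve X. Qed.

(* Two functions define the same germ at 0 as soon as they agree near 0; since
   the functions vanishing near 0 lie in every ideal [vanishing X], the quotient
   of [holo_fun] by it is also the quotient of the ring of germs. *)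
Definition vanishing (X : plane_branch) : {pred holo_fun} :=
  fun h : holo_fun => `[< \forall p \near (0 : C * C), branch_set X p -> h p = 0 >].

Fact vanishing_idealr (X : plane_branch) : idealr_closed (vanishing X).
Proof.
split.
- by apply/asboolP; near=> p.
- apply/negP => /asboolP /nbhs_singleton /(_ (branch0 X)) /eqP.
  by rewrite oner_eq0.
- move=> h f g /asboolP fX /asboolP gX; apply/asboolP.
  near=> p => Xp.
  have fp : f p = 0 by apply: (near fX p).
  have gp : g p = 0 by apply: (near gX p).
  suff: h p * f p + g p = 0 by [].
  by rewrite fp gp mulr0 addr0.
Unshelve. all: by end_near. Qed.

HB.instance Definition _ (X : plane_branch) :=
  isIdealr.Build holo_fun (vanishing X) (vanishing_idealr X).

Definition local_ring (X : plane_branch) : comNzRingType :=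
  {ideal_quot (vanishing X)}.

Definition order_at0 f (m : nat) : Prop :=
  exists a, [/\ has_expansion a f,
    exists i j, (i + j = m)%N /\ a i j != 0
  & forall i j, (i + j < m)%N -> a i j = 0].

(* The multiplicity of a plane curve is the order of its reduced equation,
   i.e. of a generator of the ideal of germs vanishing on it. *)
Definition multiplicity (X : plane_branch) (m : nat) : Prop :=
  exists f : holo_fun,
    (forall h : holo_fun, h \in vanishing X <->
       exists k : holo_fun, \forall p \near (0 : C * C), h p = k p * f p) /\
    order_at0 f m.

Definition holo_map (phi : C * C -> C * C) : Prop :=
  fst \o phi \in holomorphic_at0 /\ snd \o phi \in holomorphic_at0.

Definition local_coordinates (phi : C * C -> C * C) : Prop :=
  [/\ holo_map phi, phi 0 = 0 & exists psi : C * C -> C * C,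
    [/\ holo_map psi, psi 0 = 0,
        \forall p \near (0 : C * C), psi (phi p) = p
      & \forall q \near (0 : C * C), phi (psi q) = q]].

(* In the coordinates (z, w) = phi, the branch is parametrized by its
   normalization t |-> (t^m, g t), with g t = \sum_(k >= m) c k t^k on the disc
   |t| < r. As z = t^m, points of the image close to 0 come from small t, so
   a single disc suffices to describe the germ of the image. *)
Definition puiseux_parametrization (X : plane_branch) (m : nat) (c : nat -> C) :
    Prop :=
  exists (phi : C * C -> C * C) (r : C) (g : C -> C),
    [/\ local_coordinates phi,
        0 < r /\ (forall t, `|t| < r ->
          series (fun k => c k * t ^+ k) @ \oo --> g t),
        forall k, (k < m)%N -> c k = 0,
        forall s t, `|s| < r -> `|t| < r ->
          (s ^+ m, g s) = (t ^+ m, g t) -> s = t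
      & \forall p \near (0 : C * C),
          branch_set X p <->
          exists t, `|t| < r /\ phi p = (t ^+ m, g t)].

Definition is_min (S : set nat) (k : nat) : Prop :=
  S k /\ forall k', S k' -> (k <= k')%N.

Definition puiseux_characteristics (m : nat) (c : nat -> C) (M : nat)
    (e beta : nat -> nat) : Prop :=
  [/\ e 0%N = m,
      forall j, (1 <= j <= M)%N ->
        is_min [set k | c k != 0 /\ ~~ (e j.-1 %| k)%N] (beta j) /\
        e j = gcdn (e j.-1) (beta j)
    & e M = 1%N].

End HolomorphicFunctions.

(* Main.v *)
From HB Require Import structures.
Require Import Defs.
From mathcomp Require Import all_boot all_order all_algebra.
From mathcomp Require Import all_classical all_reals all_analysis.
From mathcomp Require Import complex generic_quotient ring_quotient ring.
From mathcomp Require Import cyclic separable cyclotomic.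

Set Implicit Arguments.
Unset Strict Implicit.
Unset Printing Implicit Defensive.

Import Order.TTheory GRing.Theory Num.Theory numFieldNormedType.Exports.
Local Open Scope classical_set_scope.
Local Open Scope ring_scope.

(** Let [m] be the multiplicity, [O] the ring of convergent series in
    [z = t ^+ m], and [d] the sum of the [(e (i - 1) - e i) * beta i]. Pulling
    functions back along [t |-> (t ^+ m, g t)] identifies the local ring of the
    curve with the subring [O[g]] of the ring of convergent series in [t], and the
    theorem says that the Briancon-Skoda number is the least [k] such that
    [d < m * k]. Two facts about orders in [t] are behind this. An element is
    integral over an ideal exactly when its order is at least that of the ideal,
    so only the conductor matters: (i) every series of order at least
    [d - (m - 1)] lies in the ring, and (ii) no element of the ring has order
    [d - m].

    Both facts come from Euler's trace form. The conjugates of [g] over [O] are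
    the [g (zeta * t)] for [zeta ^+ m = 1], and the different, the product of the
    [g t - g (zeta * t)] over [zeta <> 1], has order [d]: the difference has order
    [beta j] when [zeta] is an [e (j - 1)]-st but not an [e j]-th root of unity
    ([different_order]). For (i), interpolate a series [f] at the conjugates of
    [g]: the coefficients of the interpolation polynomial are traces of
    elements of the form [f * q / different], of order greater than [- m]. A trace
    keeps the exponents divisible by [m] only, so the coefficients lie in [O]
    ([conductor_contains]). For (ii), the trace of [g ^+ j / different] is the top
    coefficient of the remainder of [Y ^+ j] modulo the minimal polynomial of [g],
    hence lies in [O]; so does the trace of any element of the ring divided by the
    different. An element of order [d - m] would have a trace with a pole
    ([conductor_gap]).

    Given the conductor, dividing by the [l]-th power of an element of minimal
    order of an ideal gives the upper bound ([bs_property_of_conductor]), and the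
    principal ideal of [z] gives the lower bound ([conductor_of_bs_property]).

    Convergence is needed throughout, since the series produced in (i) must be
    functions near the origin. The first parts therefore develop convergent power
    series: composition ([has_expansion_comp]), inversion, and division by
    powers of [t]. Below, [m] is written [n.+1]. *)

(** * Absolutely convergent double series *)

Section DoubleSeries.
Variable R : realType.
Local Notation C := (CC R).
Implicit Types (a b : nat -> nat -> C) (p : C * C) (f g : C * C -> C).

Definition term a p (i j : nat) : C := a i j * p.1 ^+ i * p.2 ^+ j.

Lemma pser2M a b p n : pser2 a p n * pser2 b p n =
  \sum_(k < n) \sum_(k' < n) \sum_(l < n) \sum_(l' < n)
     term a p k l * term b p k' l'.
Proof.
rewrite /pser2 mulr_suml; apply: eq_bigr => k _.
rewrite mulr_sumr; apply: eq_bigr => k' _.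
by rewrite mulr_suml; apply: eq_bigr => l _; rewrite mulr_sumr.
Qed.

Lemma pser2M_sub_cauchy a b p n :
  pser2 a p n * pser2 b p n - pser2 (cauchy2 a b) p n =
  \sum_(k < n) \sum_(k' < n) \sum_(l < n) \sum_(l' < n)
    (if (k + k' < n)%N && (l + l' < n)%N then 0
     else term a p k l * term b p k' l').
Proof.
rewrite pser2M pser2_cauchy -sumrB; apply: eq_bigr => k _.
rewrite [X in _ - X]big_mkcond -sumrB /=; apply: eq_bigr => k' _.
case: ifP => _ /=; last by rewrite subr0.
rewrite -sumrB; apply: eq_bigr => l _.
rewrite [X in _ - X]big_mkcond -sumrB /=; apply: eq_bigr => l' _.
by case: ifP => _; rewrite ?subr0 // subrr.
Qed.

(** Partial sums of the l1-norm with weight [s]. Its submultiplicativity for the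
    Cauchy product is what controls products, powers and composites of series
    uniformly in the number of factors. *)
Definition wnorm (s : C) a (n : nat) : C :=
  pser2 (fun i j => `|a i j|) (s, s) n.

Lemma wnormE s a n :
  wnorm s a n = \sum_(i < n) \sum_(j < n) `|a i j| * s ^+ (i + j).
Proof.
by apply: eq_bigr => i _; apply: eq_bigr => j _; rewrite exprD mulrA.
Qed.

Lemma wnorm_term s a n i j : 0 <= s -> (i < n)%N -> (j < n)%N ->
  `|a i j| * s ^+ (i + j) <= wnorm s a n.
Proof.
move=> s0 lin ljn; rewrite wnormE (bigD1 (Ordinal lin)) //=.
rewrite (bigD1 (Ordinal ljn)) //= -addrA lerDl.
by rewrite addr_ge0 ?sumr_ge0 // => k _; rewrite ?sumr_ge0 // => *;
  rewrite mulr_ge0 ?exprn_ge0.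
Qed.

Lemma wnorm_ge0 s a n : 0 <= s -> 0 <= wnorm s a n.
Proof.
move=> s0; rewrite wnormE sumr_ge0 // => i _; rewrite sumr_ge0 // => j _.
by rewrite mulr_ge0 ?exprn_ge0.
Qed.

Lemma wnorm_cauchy s a b n : 0 <= s ->
  wnorm s (cauchy2 a b) n <= wnorm s a n * wnorm s b n.
Proof.
move=> s0; set aa := fun i j => `|a i j|; set bb := fun i j => `|b i j|.
apply: (@le_trans _ _ (pser2 (cauchy2 aa bb) (s, s) n)).
  apply: ler_sum => i _; apply: ler_sum => j _.
  rewrite -!mulrA; apply: ler_wpM2r; first by rewrite mulr_ge0 ?exprn_ge0.
  rewrite /cauchy2; apply: le_trans (ler_norm_sum _ _ _) _.
  apply: ler_sum => k _; apply: le_trans (ler_norm_sum _ _ _) _.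
  by apply: ler_sum => l _; rewrite normrM.
rewrite -subr_ge0 pser2M_sub_cauchy.
do 4 (apply: sumr_ge0 => ? _); case: ifP => // _.
by rewrite /term !mulr_ge0 ?exprn_ge0 ?normr_ge0.
Qed.

Lemma norm_term_le s tau a p i j n :
  0 <= s -> 0 <= tau <= 1 -> `|p.1| <= tau * s -> `|p.2| <= tau * s ->
  (n <= i + j)%N -> `|term a p i j| <= tau ^+ n * (`|a i j| * s ^+ (i + j)).
Proof.
move=> s0 /andP[t0 t1] p1 p2 nij; have ts0 : 0 <= tau * s by rewrite mulr_ge0.
apply: (@le_trans _ _ (`|a i j| * (tau * s) ^+ (i + j))).
  rewrite /term -mulrA normrM ler_wpM2l // exprD normrM !normrX.
  by rewrite ler_pM ?exprn_ge0 // lerXn2r ?nnegrE.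
rewrite exprMn mulrCA ler_wpM2r ?mulr_ge0 ?exprn_ge0 //.
exact: ler_wiXn2l.
Qed.

(** A term outside the square of side [n] has total degree at least [n], so
    shrinking the radius from [s] to [tau * s] gains a factor [tau ^+ n]. *)
Lemma pser2_tail s tau a p n n' :
  0 <= s -> 0 <= tau <= 1 -> `|p.1| <= tau * s -> `|p.2| <= tau * s ->
  (n <= n')%N -> `|pser2 a p n' - pser2 a p n| <= tau ^+ n * wnorm s a n'.
Proof.
move=> s0 t01 p1 p2 nn'.
have -> : pser2 a p n = \sum_(i < n') \sum_(j < n')
    (if (i < n)%N && (j < n)%N then term a p i j else 0).
  rewrite /pser2 (big_ord_widen n' (fun i =>
    \sum_(j < n) a i j * p.1 ^+ i * p.2 ^+ j)) // big_mkcond /=.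
  apply: eq_bigr => i _; case: ifP => _ /=; last by rewrite big1.
  rewrite (big_ord_widen n' (fun j => a i j * p.1 ^+ i * p.2 ^+ j)) //.
  by rewrite big_mkcond.
rewrite wnormE mulr_sumr -sumrB; apply: le_trans (ler_norm_sum _ _ _) _.
apply: ler_sum => i _; rewrite -sumrB mulr_sumr.
apply: le_trans (ler_norm_sum _ _ _) _.
apply: ler_sum => j _; case: ifPn => [_|].
  rewrite subrr normr0 !mulr_ge0 ?exprn_ge0 //; by case/andP: t01.
rewrite negb_and -!leqNgt => h; rewrite subr0; apply: norm_term_le => //.
by case/orP: h => /leq_trans->; rewrite ?leq_addr ?leq_addl.
Qed.

Lemma lim_dist_le (u : nat -> C) (v w K : C) : u @ \oo --> v ->
  (\forall n \near \oo, `|u n - w| <= K) -> `|v - w| <= K.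
Proof.
move=> uv uK; apply/ler_addgt0Pr => e e0.
have [n [n1 n2]] : exists n, `|v - u n| < e /\ `|u n - w| <= K.
  have /cvgrPdist_lt/(_ e e0) ve := uv.
  by have [n []] := filter_ex (filterI ve uK); exists n.
rewrite -(subrKA (u n)); apply: le_trans (ler_normD _ _) _.
by rewrite addrC lerD ?n2 ?ltW.
Qed.

Lemma pser2_lim_tail s Q tau a p v n :
  0 <= s -> 0 <= tau <= 1 -> `|p.1| <= tau * s -> `|p.2| <= tau * s ->
  (forall n, wnorm s a n <= Q) -> pser2 a p @ \oo --> v ->
  `|v - pser2 a p n| <= tau ^+ n * Q.
Proof.
move=> s0 t01 p1 p2 aQ av.
apply: (lim_dist_le av).
exists n => // n' /= nn'; apply: le_trans (pser2_tail _ s0 t01 p1 p2 nn') _.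
by apply: ler_wpM2l; rewrite ?exprn_ge0 //; case/andP: t01.
Qed.

(** Absolute convergence: [s] is the radius on which the l1-norm is bounded by
    [Q], while convergence to [f] is only asked on half that radius, where
    the error of the [n]-th partial sum is at most [Q / 2 ^ n]. *)
Definition abs_expansion (s Q : C) a f : Prop :=
  [/\ 0 < s, forall n, wnorm s a n <= Q
    & forall p, `|p.1| <= 2^-1 * s -> `|p.2| <= 2^-1 * s ->
        pser2 a p @ \oo --> f p].

Lemma abs_expansion_ge0 s Q a f : abs_expansion s Q a f -> 0 <= Q.
Proof. by move=> [s0 + _] => /(_ 0%N); apply: le_trans; apply/wnorm_ge0/ltW. Qed.

Lemma half01 : 0 <= (2^-1 : C) <= 1.
Proof. by rewrite invr_ge0 ler0n invf_le1 ?ltr0n // ler1n. Qed.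

Lemma half_ge0 : 0 <= (2^-1 : C). Proof. by case/andP: half01. Qed.
Lemma half_le1 : (2^-1 : C) <= 1. Proof. by case/andP: half01. Qed.

Lemma geo_sum_le2 n : \sum_(i < n) (2^-1 : C) ^+ i <= 2.
Proof.
suff -> : \sum_(i < n) (2^-1 : C) ^+ i = 2 - 2 * 2^-1 ^+ n.
  by rewrite gerBl mulr_ge0 ?exprn_ge0 ?half_ge0.
elim: n => [|n IH]; first by rewrite big_ord0 expr0 mulr1 subrr.
rewrite big_ord_recr /= IH exprS mulrA mulfV ?pnatr_eq0 // mul1r.
by rewrite mulr_natl mulr2n opprD addrA subrK.
Qed.

Lemma geo_sum2_le4 n : \sum_(i < n) \sum_(j < n) (2^-1 : C) ^+ (i + j) <= 4.
Proof.
under eq_bigr => i _ do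
  (under eq_bigr => j _ do rewrite exprD; rewrite -mulr_sumr).
have -> : 4 = 2 * 2 :> C by rewrite -natrM.
have ge0 : 0 <= \sum_(i < n) (2^-1 : C) ^+ i.
  by apply: sumr_ge0 => i _; rewrite exprn_ge0 ?half_ge0.
by rewrite -mulr_suml ler_pM ?geo_sum_le2.
Qed.

Lemma has_abs_expansion a f : has_expansion a f ->
  exists s Q, abs_expansion s Q a f.
Proof.
move=> [r [B [r0 aB af]]].
have B0 : 0 <= B by apply: le_trans (aB 0%N 0%N); rewrite mulr_ge0 ?exprn_ge0 ?(ltW r0).
have h0 : 0 < (2^-1 : C) by rewrite invr_gt0 ltr0n.
exists (2^-1 * r), (B * 4); split; first by rewrite mulr_gt0.
  move=> n; rewrite wnormE; apply: le_trans (ler_wpM2l B0 (geo_sum2_le4 n)).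
  rewrite mulr_sumr; apply: ler_sum => i _; rewrite mulr_sumr.
  apply: ler_sum => j _; rewrite exprMn mulrCA [leRHS]mulrC ler_wpM2l ?exprn_ge0 ?half_ge0 //.
have lt : 2^-1 * (2^-1 * r) < r.
  by rewrite mulrA gtr_pMl // -invfM -natrM invf_lt1 ?ltr0n ?ltr1n.
by move=> p p1 p2; apply: af; [exact: le_lt_trans p1 lt|exact: le_lt_trans p2 lt].
Qed.

Lemma abs_has_expansion s Q a f : abs_expansion s Q a f -> has_expansion a f.
Proof.
move=> [s0 aQ af]; have h0 : 0 < (2^-1 : C) by rewrite invr_gt0 ltr0n.
have hs0 : 0 < 2^-1 * s by rewrite mulr_gt0.
exists (2^-1 * s), Q; split => // [i j|p /ltW p1 /ltW p2]; last exact: af.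
apply: le_trans (aQ (i + j).+1).
apply: le_trans (@wnorm_term s a _ i j (ltW s0) _ _); rewrite ?ltnS ?leq_addr ?leq_addl //.
by rewrite ler_wpM2l // lerXn2r ?nnegrE ?(ltW s0) ?(ltW hs0) // ger_pMl // half_le1.
Qed.

Definition vanish_below (N : nat) a := forall i j, (i + j < N)%N -> a i j = 0.

Lemma abs_expansion_shrink s Q t N a f : 0 < t <= 1 -> vanish_below N a ->
  abs_expansion s Q a f -> abs_expansion (t * s) (t ^+ N * Q) a f.
Proof.
move=> /andP[t0 t1] aN [s0 aQ af]; split; first exact: mulr_gt0.
  move=> n; have tN0 : 0 <= t ^+ N by rewrite exprn_ge0 ?ltW.
  apply: le_trans (ler_wpM2l tN0 (aQ n)).
  rewrite !wnormE mulr_sumr; apply: ler_sum => i _.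
  rewrite mulr_sumr; apply: ler_sum => j _.
  have [lt|ge] := ltnP (i + j) N; first by rewrite aN // normr0 !mul0r mulr0.
  rewrite exprMn mulrCA ler_wpM2r ?mulr_ge0 ?exprn_ge0 ?(ltW s0) //.
  by rewrite ler_wiXn2l // ltW.
have le : 2^-1 * (t * s) <= 2^-1 * s.
  by rewrite ler_wpM2l ?half_ge0 // ger_pMl.
by move=> p p1 p2; apply: af; [exact: le_trans p1 le|exact: le_trans p2 le].
Qed.

(** A term missing from the Cauchy product has total degree at least [n], hence
    carries a factor [2 ^- n] on half the radius; the difference between the
    product of the partial sums and the partial sum of the product is therefore
    at most [2 ^- n * (Q * Q')]. *)
Lemma abs_expansionM s Q Q' a b f g :
  abs_expansion s Q a f -> abs_expansion s Q' b g ->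
  abs_expansion s (Q * Q') (cauchy2 a b) (f * g).
Proof.
move=> Ha Hb; have Q0 := abs_expansion_ge0 Ha; have Q'0 := abs_expansion_ge0 Hb.
have [s0 aQ af] := Ha; have [_ bQ bg] := Hb; have s0' := ltW s0.
have sQ n : wnorm s a n * wnorm s b n <= Q * Q'.
  exact: ler_pM (wnorm_ge0 _ _ s0') (wnorm_ge0 _ _ s0') (aQ n) (bQ n).
split; [exact: s0|by move=> n; apply: le_trans (wnorm_cauchy _ _ _ s0') (sQ n)|].
move=> p p1 p2.
have err0 : (fun n => pser2 a p n * pser2 b p n - pser2 (cauchy2 a b) p n)
    @ \oo --> (0 : C).
  have QQ0 := mulr_ge0 Q0 Q'0; apply: (CC_cvg0 QQ0) => n.
  apply: (@le_trans _ _ (2^-1 ^+ n * (Q * Q'))); last first.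
    rewrite mulrC ler_wpM2l // exprVn lef_pV2 ?posrE ?exprn_gt0 ?ltr0n //.
    by rewrite -natrX ler_nat ltn_expl.
  have h0 : 0 <= (2^-1 ^+ n : C) by rewrite exprn_ge0 ?half_ge0.
  apply: le_trans (ler_wpM2l h0 (sQ n)); rewrite pser2M_sub_cauchy /wnorm pser2M.
  rewrite mulr_sumr; apply: le_trans (ler_norm_sum _ _ _) _; apply: ler_sum => k _.
  rewrite mulr_sumr; apply: le_trans (ler_norm_sum _ _ _) _; apply: ler_sum => k' _.
  rewrite mulr_sumr; apply: le_trans (ler_norm_sum _ _ _) _; apply: ler_sum => l _.
  rewrite mulr_sumr; apply: le_trans (ler_norm_sum _ _ _) _; apply: ler_sum => l' _.
  have fac c (i j : nat) : term (fun i j => `|c i j|) (s, s) i j = `|c i j| * s ^+ (i + j).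
    by rewrite /term /= exprD mulrA.
  case: ifPn => [_|].
    by rewrite normr0 !fac !mulr_ge0 ?exprn_ge0.
  rewrite negb_and -!leqNgt => ge.
  rewrite normrM !fac.
  apply: le_trans (_ : (2^-1 ^+ (k + l) * (`|a k l| * s ^+ (k + l))) *
     (2^-1 ^+ (k' + l') * (`|b k' l'| * s ^+ (k' + l'))) <= _).
    by rewrite ler_pM ?norm_term_le ?half01.
  rewrite mulrACA -exprD ler_wpM2r ?mulr_ge0 ?exprn_ge0 //.
  rewrite ler_wiXn2l ?half_ge0 ?half_le1 //.
  by rewrite addnACA; case/orP: ge => h; rewrite (leq_trans h) ?leq_addr ?leq_addl.
have -> : (f * g) p = f p * g p - 0 by rewrite subr0.
have -> : pser2 (cauchy2 a b) p = (fun n => pser2 a p n * pser2 b p n -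
   (pser2 a p n * pser2 b p n - pser2 (cauchy2 a b) p n)).
  by apply/funext => n; rewrite subKr.
have /= := cvgB (cvgM (af p p1 p2) (bg p p1 p2)) err0; apply.
Qed.

End DoubleSeries.

(** * Composition of power series *)

Section Composition.
Variable R : realType.
Local Notation C := (CC R).
Implicit Types (a b : nat -> nat -> C) (p : C * C) (f g : C * C -> C).

Lemma cvg_geometric_rate (u : nat -> C) (v K : C) : 0 <= K ->
  (forall n, `|v - u n| <= 2^-1 ^+ n * K) -> u @ \oo --> v.
Proof.
move=> K0 uK; have w0 : (fun n => v - u n) @ \oo --> (0 : C).
  apply: (CC_cvg0 K0) => n; apply: le_trans (uK n) _.
  rewrite mulrC ler_wpM2l // exprVn lef_pV2 ?posrE ?exprn_gt0 ?ltr0n //.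
  by rewrite -natrX ler_nat ltn_expl.
apply/cvgrPdist_lt => e e0.
have /cvgrPdist_lt/(_ e e0) := w0.
by apply: filterS => n; rewrite sub0r normrN.
Qed.

Definition delta00 (i j : nat) : C := ((i == 0%N) && (j == 0%N))%:R.

Lemma pser2_delta00 p n : pser2 delta00 p n = (0 < n)%N%:R.
Proof.
case: n => [|n]; rewrite /pser2 ?big_ord0 // big_ord_recl big_ord_recl /=.
rewrite [X in _ + X + _]big1 => [|j _]; last by rewrite /delta00 /= !mul0r.
rewrite big1 => [|i _]; last by rewrite big1 // => j _; rewrite /delta00 /= !mul0r.
by rewrite /delta00 !expr0 !mulr1 !addr0.
Qed.

Lemma abs_expansion_delta00 s : 0 < s -> abs_expansion s 1 delta00 1.
Proof.
move=> s0; split; [exact: s0| |] => [n|p _ _].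
  have -> : wnorm s delta00 n = pser2 delta00 (s, s) n.
    apply: eq_bigr => i _; apply: eq_bigr => j _; congr (_ * _ * _).
    by rewrite /delta00 normr_nat.
  by rewrite pser2_delta00 lern1; case: n.
apply: (@cvg_geometric_rate _ _ 1) => // n; rewrite pser2_delta00 mulr1.
case: n => [|n]; first by rewrite subr0 expr0 normr1.
by rewrite subrr normr0 exprn_ge0 // half_ge0.
Qed.

Definition cauchy_pow a i : nat -> nat -> C := iter i (cauchy2 a) delta00.

Lemma abs_expansionX s Q a f i : abs_expansion s Q a f ->
  abs_expansion s (Q ^+ i) (cauchy_pow a i) (f ^+ i).
Proof.
move=> Ha; elim: i => [|i IH]; first by have [s0 _ _] := Ha; exact: abs_expansion_delta00.
by rewrite !exprS; exact: abs_expansionM.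
Qed.

Lemma vanish_below_cauchy N N' a b : vanish_below N a -> vanish_below N' b ->
  vanish_below (N + N') (cauchy2 a b).
Proof.
move=> aN bN' i j lt; rewrite /cauchy2 big1 // => k _; rewrite big1 // => l _.
have [klN|Nkl] := ltnP (k + l) N; first by rewrite aN // mul0r.
rewrite bN' ?mulr0 // -(ltn_add2l N); apply: leq_ltn_trans lt.
apply: leq_trans (leq_add Nkl (leqnn _)) _.
by rewrite addnACA !subnKC // -ltnS.
Qed.

Lemma vanish_below_pow N a i : vanish_below N a -> vanish_below (N * i) (cauchy_pow a i).
Proof.
move=> aN; elim: i => [|i IH]; first by rewrite muln0.
by rewrite mulnS; exact: vanish_below_cauchy.
Qed.

Lemma abs_expansion_radius s s' Q a f : 0 < s' <= s ->
  abs_expansion s Q a f -> abs_expansion s' Q a f.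
Proof.
move=> /andP[s'0 s's] Ha; have [s0 _ _] := Ha.
have t01 : 0 < s' / s <= 1 by rewrite divr_gt0 // ler_pdivrMr // mul1r.
have := abs_expansion_shrink (N := 0) t01 (fun i j lt => False_ind _ (notF lt)) Ha.
by rewrite expr0 mul1r divfK // gt_eqF.
Qed.

Lemma abs_expansion_weaken s Q Q' a f : Q <= Q' ->
  abs_expansion s Q a f -> abs_expansion s Q' a f.
Proof.
move=> QQ' [s0 aQ af]; split; [exact: s0| |exact: af] => n.
exact: le_trans (aQ n) QQ'.
Qed.

(** Without constant term, shrinking the radius by [t] multiplies the norm by
    at most [t]. *)
Lemma small_abs_expansion a f rho : has_expansion a f -> a 0%N 0%N = 0 -> 0 < rho ->
  exists2 s, 0 < s & abs_expansion s rho a f.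
Proof.
move=> /has_abs_expansion[s [Q Ha]] a0 r0; have Q0 := abs_expansion_ge0 Ha.
have a1 : vanish_below 1 a by case=> [|i] [|j].
have rQ : 0 < rho + Q by rewrite ltr_wpDr.
have t01 : 0 < rho / (rho + Q) <= 1.
  by rewrite divr_gt0 //= ler_pdivrMr // mul1r lerDl.
have [s0 _ _] := Ha.
exists (rho / (rho + Q) * s); first by rewrite mulr_gt0 //; case/andP: t01.
apply: abs_expansion_weaken (abs_expansion_shrink t01 a1 Ha).
by rewrite expr1 mulrAC ler_pdivrMr // ler_pM2l // lerDr ltW.
Qed.

Lemma common_radius (s s' : C) : 0 < s -> 0 < s' ->
  exists t, [/\ 0 < t, t <= s & t <= s'].
Proof.
move=> s0 s'0; case: (real_leP (gtr0_real s0) (gtr0_real s'0)) => h.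
  by exists s; split => //; rewrite lexx.
by exists s'; split => //; apply: ltW.
Qed.

(** The sums stop at [k + l] because a monomial of higher degree in series
    without constant term does not reach the coefficient of index [(k, l)]. *)
Definition comp_coef a b b' (k l : nat) : C :=
  \sum_(i < (k + l).+1) \sum_(j < (k + l).+1)
    a i j * cauchy2 (cauchy_pow b i) (cauchy_pow b' j) k l.

Lemma vanish_below_monomial M b b' i j : vanish_below M b -> vanish_below M b' ->
  vanish_below (M * (i + j)) (cauchy2 (cauchy_pow b i) (cauchy_pow b' j)).
Proof.
by move=> bM b'M; rewrite mulnDr; apply: vanish_below_cauchy; exact: vanish_below_pow.
Qed.

(** Each of the [i + j] factors of the monomial substituted for
    [x ^+ i * y ^+ j] contributes order at least [M]. *)
Lemma vanish_below_comp M N a b b' :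
  vanish_below N a -> vanish_below M b -> vanish_below M b' ->
  vanish_below (M * N) (comp_coef a b b').
Proof.
move=> aN bM b'M k l lt; rewrite /comp_coef big1 // => i _; rewrite big1 // => j _.
have [ijN|Nij] := ltnP (i + j) N; first by rewrite aN // mul0r.
rewrite (vanish_below_monomial bM b'M) ?mulr0 //.
by apply: leq_trans lt _; rewrite leq_mul2l Nij orbT.
Qed.

Lemma comp_coef_widen a b b' k l W : vanish_below 1 b -> vanish_below 1 b' ->
  (k + l < W)%N -> comp_coef a b b' k l = \sum_(i < W) \sum_(j < W)
    a i j * cauchy2 (cauchy_pow b i) (cauchy_pow b' j) k l.
Proof.
move=> b1 b1' klW; pose F i j := a i j * cauchy2 (cauchy_pow b i) (cauchy_pow b' j) k l.
have F0 i j : (k + l < i + j)%N -> F i j = 0.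
  by move=> lt; rewrite /F (vanish_below_monomial b1 b1') ?mulr0 // mul1n.
rewrite /comp_coef (big_ord_widen W (fun i => \sum_(j < (k + l).+1) F i j)) //.
rewrite big_mkcond; apply: eq_bigr => i _ /=; case: ltnP => ikl.
  rewrite (big_ord_widen W (F i)) // big_mkcond; apply: eq_bigr => j _ /=.
  by case: ltnP => // jkl; rewrite [RHS]F0 ?ltn_addl.
by rewrite [RHS]big1 // => j _; apply: F0; rewrite ltn_addr.
Qed.

(** Substituting convergent series without constant term. The substituted
    series are first shrunk to norm [rho], half the radius on which [a] is
    absolutely summable, so that both the norm of the composite and its error
    term are controlled by the norm of [a]. *)
Lemma has_expansion_comp a b b' f g g' : has_expansion a f ->
  has_expansion b g -> has_expansion b' g' -> b 0%N 0%N = 0 -> b' 0%N 0%N = 0 ->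
  has_expansion (comp_coef a b b') (fun p => f (g p, g' p)).
Proof.
move=> /has_abs_expansion[r [Q Ha]] Hb Hb' b0 b'0.
have Q0 := abs_expansion_ge0 Ha; have [r0 aQ af] := Ha.
set rho := 2^-1 * r; have rho0 : 0 < rho by rewrite mulr_gt0 // invr_gt0 ltr0n.
have [s1 s10 {}Hb] := small_abs_expansion Hb b0 rho0.
have [s2 s20 {}Hb'] := small_abs_expansion Hb' b'0 rho0.
have [s [s0 ss1 ss2]] := common_radius s10 s20.
have ss1' : 0 < s <= s1 by rewrite s0.
have ss2' : 0 < s <= s2 by rewrite s0.
have {}Hb := abs_expansion_radius ss1' Hb.
have {}Hb' := abs_expansion_radius ss2' Hb'.
pose e i j := cauchy2 (cauchy_pow b i) (cauchy_pow b' j).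
have He i j : abs_expansion s (rho ^+ (i + j)) (e i j) (g ^+ i * g' ^+ j).
  by rewrite exprD; apply: abs_expansionM; apply: abs_expansionX.
have b1 : vanish_below 1 b by case=> [|i] [|j].
have b1' : vanish_below 1 b' by case=> [|i] [|j].
have aQ' n : \sum_(i < n) \sum_(j < n) `|a i j| * rho ^+ (i + j) <= Q.
  apply: le_trans (aQ n); rewrite wnormE.
  apply: ler_sum => i _; apply: ler_sum => j _; rewrite ler_wpM2l //.
  by rewrite lerXn2r ?nnegrE ?(ltW r0) ?(ltW rho0) // ger_pMl // half_le1.
(* The coefficients of index below [n] in both variables only involve monomials
   of degree below [n + n]. *)
have lt2 n (k l : 'I_n) : (k + l < n + n)%N.
  by rewrite -addSn leq_add // ltnW.
have s0' := ltW s0.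
have half_n_ge0 n : 0 <= (2^-1 : C) ^+ n by rewrite exprn_ge0 ?half_ge0.
apply: (@abs_has_expansion _ s Q); split; first exact: s0.
  move=> n; apply: le_trans (aQ' (n + n)%N); rewrite wnormE.
  apply: (@le_trans _ _ (\sum_(i < n + n) \sum_(j < n + n)
      `|a i j| * wnorm s (e i j) n)); last first.
    apply: ler_sum => i _; apply: ler_sum => j _; rewrite ler_wpM2l //.
    by have [_ + _] := He i j; apply.
  apply: (@le_trans _ _ (\sum_(k < n) \sum_(l < n) \sum_(i < n + n)
      \sum_(j < n + n) `|a i j| * (`|e i j k l| * s ^+ (k + l)))).
    apply: ler_sum => k _; apply: ler_sum => l _.
    rewrite (comp_coef_widen _ b1 b1' (lt2 _ k l)).
    under [leRHS]eq_bigr => i _ do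
      (under eq_bigr => j _ do rewrite mulrA; rewrite -mulr_suml).
    rewrite -mulr_suml ler_wpM2r ?exprn_ge0 //.
    apply: le_trans (ler_norm_sum _ _ _) _; apply: ler_sum => i _.
    apply: le_trans (ler_norm_sum _ _ _) _; apply: ler_sum => j _.
    by rewrite normrM.
  under eq_bigr => k _ do rewrite exchange_big /=.
  rewrite exchange_big /=; apply: ler_sum => i _.
  under eq_bigr => k _ do rewrite exchange_big /=.
  rewrite exchange_big /=; apply: ler_sum => j _.
  rewrite wnormE mulr_sumr; apply: ler_sum => k _.
  by rewrite mulr_sumr.
move=> p p1 p2.
have gp : `|g p| <= rho.
  have [_ bQ /(_ p p1 p2) cv] := Hb.
  have := pser2_lim_tail 0 s0' (half01 R) p1 p2 bQ cv.
  by rewrite /pser2 big_ord0 subr0 expr0 mul1r.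
have g'p : `|g' p| <= rho.
  have [_ bQ /(_ p p1 p2) cv] := Hb'.
  have := pser2_lim_tail 0 s0' (half01 R) p1 p2 bQ cv.
  by rewrite /pser2 big_ord0 subr0 expr0 mul1r.
apply: (@cvg_geometric_rate _ _ (Q + Q)); first exact: addr_ge0.
move=> n; rewrite mulrDr.
rewrite -(subrKA (pser2 a (g p, g' p) (n + n))).
apply: le_trans (ler_normD _ _) _; apply: lerD.
  have := pser2_lim_tail (p := (g p, g' p)) (n + n) (ltW r0) (half01 R) gp g'p aQ
    (af (g p, g' p) gp g'p).
  move/le_trans; apply; rewrite ler_wpM2r // ler_wiXn2l ?half_ge0 ?half_le1 //.
  by rewrite leq_addr.
have -> : pser2 (comp_coef a b b') p n =
    \sum_(i < n + n) \sum_(j < n + n) a i j * pser2 (e i j) p n.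
  transitivity (\sum_(k < n) \sum_(l < n) \sum_(i < n + n)
      \sum_(j < n + n) a i j * (e i j k l * p.1 ^+ k * p.2 ^+ l)).
    apply: eq_bigr => k _; apply: eq_bigr => l _.
    rewrite (comp_coef_widen _ b1 b1' (lt2 _ k l)).
    rewrite !mulr_suml; apply: eq_bigr => i _.
    by rewrite !mulr_suml; apply: eq_bigr => j _; rewrite !mulrA.
  under eq_bigr => k _ do rewrite exchange_big /=.
  rewrite exchange_big /=; apply: eq_bigr => i _.
  under eq_bigr => k _ do rewrite exchange_big /=.
  rewrite exchange_big /=; apply: eq_bigr => j _.
  rewrite /pser2 mulr_sumr; apply: eq_bigr => k _.
  by rewrite mulr_sumr.
apply: le_trans (ler_wpM2l (half_n_ge0 n) (aQ' (n + n)%N)).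
rewrite /pser2 -sumrB mulr_sumr; apply: le_trans (ler_norm_sum _ _ _) _.
apply: ler_sum => i _; rewrite -sumrB mulr_sumr.
apply: le_trans (ler_norm_sum _ _ _) _; apply: ler_sum => j _.
have -> : a i j * (g p, g' p).1 ^+ i * (g p, g' p).2 ^+ j -
    a i j * pser2 (e i j) p n =
    a i j * ((g ^+ i * g' ^+ j) p - pser2 (e i j) p n).
  by rewrite mulrBr mulrA !fctE.
rewrite normrM mulrCA ler_wpM2l //.
have [_ eQ /(_ p p1 p2) cv] := He i j.
exact: pser2_lim_tail s0' (half01 R) p1 p2 eQ cv.
Qed.

End Composition.

(** * Germs in one variable *)

Section OneVariable.
Variable R : realType.
Local Notation C := (CC R).
Implicit Types (a b : nat -> nat -> C) (c : nat -> C) (p : C * C).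
Implicit Types (f g : C * C -> C) (F G : C -> C).

Definition pser1 c (t : C) (n : nat) : C := \sum_(i < n) c i * t ^+ i.

Definition has_series c F : Prop :=
  exists r B : C, [/\ 0 < r, forall k, `|c k| * r ^+ k <= B
    & forall t, `|t| < r -> pser1 c t @ \oo --> F t].

Definition hol1 : {pred C -> C} := fun F => `[< exists c, has_series c F >].

(** A series in one variable as a double series not involving the second one;
    the ring structure and the composition of germs in one variable are inherited
    from two variables in this way. *)
Definition in_fst c (i j : nat) : C := if j == 0%N then c i else 0.

Lemma has_series_fst c F : has_series c F -> has_expansion (in_fst c) (F \o fst).
Proof.
move=> [r [B [r0 cB cF]]]; exists r, B; split; [exact: r0| |] => [i j|p p1 _].
  rewrite /in_fst; case: eqP => [->|_]; first by rewrite addn0.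
  by rewrite normr0 mul0r (le_trans _ (cB 0%N)) // mulr_ge0 ?exprn_ge0 ?(ltW r0).
have -> : pser2 (in_fst c) p = pser1 c p.1; last exact: cF.
apply/funext => n; apply: eq_bigr => i _.
case: n i => [[//]|n] i; rewrite big_ord_recl /in_fst /= expr0 mulr1.
by rewrite big1 ?addr0 // => j _; rewrite !mul0r.
Qed.

Lemma has_expansion_series a f : has_expansion a f ->
  has_series (fun i => a i 0%N) (fun t => f (t, 0)).
Proof.
move=> [r [B [r0 aB af]]]; exists r, B; split; [exact: r0| |] => [k|t tr].
  by rewrite -{2}[k]addn0.
have -> : pser1 (fun i => a i 0%N) t = pser2 a (t, 0).
  apply/funext => n; apply: eq_bigr => i _.
  case: n i => [[//]|n] i; rewrite big_ord_recl /= expr0 mulr1.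
  by rewrite big1 ?addr0 // => j _; rewrite /= expr0n mulr0.
by apply: af; rewrite //= normr0.
Qed.

Lemma hol1_fst F : (F \in hol1) = (F \o fst \in @holomorphic_at0 R).
Proof.
apply/asboolP/asboolP => [[c /has_series_fst]|[a /has_expansion_series]] H.
  by exists (in_fst c).
by exists (fun i => a i 0%N).
Qed.

Fact hol1_subring : subring_closed hol1.
Proof.
split=> [|F G|F G]; rewrite !hol1_fst; first exact: holomorphic_at0_1.
  exact: holomorphic_at0B.
exact: holomorphic_at0M.
Qed.

HB.instance Definition _ := GRing.isSubringClosed.Build (C -> C) hol1 hol1_subring.

Lemma hol1_cst (x : C) : (fun=> x) \in hol1.
Proof.
apply/asboolP; exists (fun k => if k == 0%N then x else 0), 1, `|x|.
split; [exact: ltr01| |] => [k|t _].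
  by rewrite expr1n mulr1; case: eqP; rewrite ?normr0.
apply: (@cvg_near_cst _ _ x); exists 1%N => // -[//|n] _.
by rewrite /pser1 big_ord_recl expr0 mulr1 big1 ?addr0 // => i _; rewrite mul0r.
Qed.

Lemma has_series_exp m : has_series (fun k => (k == m)%:R) (fun t : C => t ^+ m).
Proof.
exists 1, 1; split; [exact: ltr01| |] => [k|t _].
  by rewrite expr1n mulr1 normr_nat; case: eqP; rewrite ?ler01.
apply: (@cvg_near_cst _ _ (t ^+ m)); exists m.+1 => // N /= mN.
rewrite /pser1 (bigD1 (Ordinal mN)) //= eqxx mul1r big1 ?addr0 // => i.
by rewrite -val_eqE /= => /negbTE ->; rewrite mul0r.
Qed.

Lemma hol1_exp m : (fun t : C => t ^+ m) \in hol1.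
Proof. by apply/asboolP; eexists; exact: has_series_exp. Qed.

Lemma hol1_id : id \in hol1.
Proof. exact: (hol1_exp 1). Qed.

Lemma cvg_reindex (u : nat -> C) (v : C) (h : nat -> nat) :
  (forall n, (n <= h n)%N) -> u @ \oo --> v -> (fun n => u (h n)) @ \oo --> v.
Proof.
move=> hn /cvgrPdist_lt uv; apply/cvgrPdist_lt => e /uv[N _ HN].
by exists N => // n /= Nn; apply: HN => /=; exact: leq_trans Nn (hn n).
Qed.

Lemma holomorphic_snd : snd \in @holomorphic_at0 R.
Proof.
apply/asboolP; exists (fun i j => ((i == 0%N) && (j == 1%N))%:R), 1, 1.
split; [exact: ltr01| |] => [i j|p _ _].
  by rewrite expr1n mulr1 normr_nat; case: (_ && _); rewrite ?ler01.
apply: (@cvg_near_cst _ _ p.2); exists 2%N => // -[//|[//|n]] _.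
rewrite /pser2 big_ord_recl [X in _ + X]big1 => [|i _]; last first.
  by rewrite big1 // => j _; rewrite /= !mul0r.
rewrite 2!big_ord_recl /= !mul0r add0r expr0 !mul1r expr1 big1 ?addr0 // => j _.
by rewrite !mul0r.
Qed.

Lemma pser1_0 c n : pser1 c 0 n.+1 = c 0%N.
Proof.
rewrite /pser1 big_ord_recl expr0 mulr1 big1 ?addr0 // => i _.
by rewrite expr0n mulr0.
Qed.

Lemma has_series0 c F : has_series c F -> F 0 = c 0%N.
Proof.
move=> [r [B [r0 _ cF]]].
have cv : pser1 c 0 @ \oo --> F 0 by apply: cF; rewrite normr0.
have cst : pser1 c 0 @ \oo --> c 0%N.
  by apply: cvg_near_cst; exists 1%N => // -[//|n] _; exact: pser1_0.
exact: (@norm_cvg_unique _ C _ _ _ _ cv cst).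
Qed.

Lemma has_expansion0 a f : has_expansion a f -> f 0 = a 0%N 0%N.
Proof. by move=> /has_expansion_series/has_series0. Qed.

(** The quotient is taken pointwise away from the origin, so the factorization
    holds for every [t] and not only near the origin. *)
Lemma has_series_factor c F n : has_series c F -> (forall k, (k < n)%N -> c k = 0) ->
  exists2 G, has_series (fun k => c (n + k)%N) G & forall t, F t = t ^+ n * G t.
Proof.
move=> HF cn; have F0 := has_series0 HF; have [r [B [r0 cB cF]]] := HF.
exists (fun t => if t == 0 then c n else F t / t ^+ n); last first.
  move=> t; case: eqP => [->|/eqP t0]; last by rewrite mulrC divfK ?expf_neq0.
  by rewrite F0; case: n cn => [|n] cn; rewrite ?mul1r // cn // expr0n mul0r.
exists r, (B / r ^+ n); split; [exact: r0| |] => [k|t tr].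
  by rewrite ler_pdivlMr ?exprn_gt0 // -mulrA -exprD [(k + n)%N]addnC.
case: eqP => [->|/eqP t0].
  apply: cvg_near_cst; exists 1%N => // -[//|k] _.
  by rewrite pser1_0 addn0.
have -> : pser1 (fun k => c (n + k)%N) t = (fun k => pser1 c t (n + k) / t ^+ n).
  apply/funext => k; rewrite /pser1 big_split_ord /= [X in X + _]big1 => [|i _].
    rewrite add0r mulr_suml; apply: eq_bigr => i _.
    by rewrite exprD mulrCA [RHS]mulrC mulKf ?expf_neq0.
  by rewrite cn // mul0r.
apply: cvgMr_tmp; apply: (cvg_reindex (h := addn n)); last exact: cF.
by move=> k; rewrite leq_addl.
Qed.

Lemma nbhs0_ball (P : C -> Prop) : (\forall t \near (0 : C), P t) <->
  exists2 e : C, 0 < e & forall t, `|t| < e -> P t.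
Proof.
split=> [/nbhs_norm0P[e e0 H]|[e e0 H]]; first by exists e => // t te; apply: H.
by apply/nbhs_norm0P; exists e => // t te; exact: H.
Qed.

Lemma nbhs0_polydisc (P : C * C -> Prop) : (\forall p \near (0 : C * C), P p) <->
  exists2 e : C, 0 < e & forall p, `|p.1| < e -> `|p.2| < e -> P p.
Proof.
split=> [/nbhs_ballP[e /= e0 H]|[e e0 H]].
  by exists e => // p p1 p2; apply: H; split; rewrite -ball_normE /= sub0r normrN.
apply/nbhs_ballP; exists e => //= p [].
by rewrite -!ball_normE /= !sub0r !normrN; exact: H.
Qed.

(** The tail estimate at [n = 1], where the partial sum is the value at the
    origin. *)
Lemma holomorphic_lipschitz f : f \in @holomorphic_at0 R ->
  exists s K : C, [/\ 0 < s, 0 <= K & forall tau p, 0 <= tau <= 1 ->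
    `|p.1| <= tau * s -> `|p.2| <= tau * s -> `|f p - f 0| <= tau * K].
Proof.
move=> /asboolP[a Ha]; rewrite (has_expansion0 Ha).
have [s [Q HQ]] := has_abs_expansion Ha; have Q0 := abs_expansion_ge0 HQ.
have [s0 aQ af] := HQ.
have h0 : 0 < (2^-1 : C) by rewrite invr_gt0 ltr0n.
exists (2^-1 * s), Q; split; [by rewrite mulr_gt0|exact: Q0|].
move=> tau p t01 p1 p2; have [t0 t1] := andP t01.
have le : tau * (2^-1 * s) <= 2^-1 * s by rewrite ler_piMl // mulr_ge0 // ltW.
have le' : tau * (2^-1 * s) <= tau * s.
  by rewrite ler_wpM2l // ger_pMl // half_le1.
have cv := af p (le_trans p1 le) (le_trans p2 le).
have := pser2_lim_tail 1 (ltW s0) t01 (le_trans p1 le') (le_trans p2 le') aQ cv.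
by rewrite /pser2 !big_ord1 !expr0 !mulr1 expr1.
Qed.

Lemma holomorphic_near f (P : C -> Prop) : f \in @holomorphic_at0 R -> f 0 = 0 ->
  (\forall t \near (0 : C), P t) -> \forall p \near (0 : C * C), P (f p).
Proof.
move=> /holomorphic_lipschitz[s [K [s0 K0 lip]]] f0 /nbhs0_ball[e e0 H].
have eK : 0 < e + K by rewrite ltr_wpDr.
have t0 : 0 < e / (e + K) by rewrite divr_gt0.
have t1 : e / (e + K) <= 1 by rewrite ler_pdivrMr // mul1r lerDl.
apply/nbhs0_polydisc; exists (e / (e + K) * s); first exact: mulr_gt0.
move=> p /ltW p1 /ltW p2; apply: H; rewrite -[f p]subr0 -f0.
apply: le_lt_trans (lip _ p _ p1 p2) _; first by rewrite (ltW t0).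
by rewrite mulrAC ltr_pdivrMr // ltr_pM2l // ltrDr.
Qed.

Lemma holo_map_near (phi : C * C -> C * C) (P : C * C -> Prop) :
  holo_map phi -> phi 0 = 0 ->
  (\forall p \near (0 : C * C), P p) -> \forall p \near (0 : C * C), P (phi p).
Proof.
move=> [h1 h2] phi0 /nbhs0_polydisc[e e0 H].
have near_e : \forall t \near (0 : C), `|t| < e by apply/nbhs0_ball; exists e.
have := holomorphic_near h1 (congr1 fst phi0) near_e.
have := holomorphic_near h2 (congr1 snd phi0) near_e.
by apply: filterS2 => p; move=> H2 H1; exact: H.
Qed.

Lemma near_slice (P : C * C -> Prop) :
  (\forall p \near (0 : C * C), P p) -> \forall t \near (0 : C), P (t, 0).
Proof.
move=> /nbhs0_polydisc[e e0 H]; apply/nbhs0_ball; exists e => // t te.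
by apply: H => //=; rewrite normr0.
Qed.

Lemma hol1_near2 F G (P : C * C -> Prop) : F \in hol1 -> G \in hol1 ->
  F 0 = 0 -> G 0 = 0 ->
  (\forall p \near (0 : C * C), P p) -> \forall t \near (0 : C), P (F t, G t).
Proof.
rewrite !hol1_fst => hF hG F0 G0 HP.
apply: (near_slice (P := fun p => P (F p.1, G p.1))).
apply: (@holo_map_near (fun p => (F p.1, G p.1)) _ _ _ HP); last by rewrite /= F0 G0.
by split; [exact: hF|exact: hG].
Qed.

Lemma dnbhs0_ball (P : C -> Prop) : (\forall t \near 0^', P t) <->
  exists2 e : C, 0 < e & forall t, `|t| < e -> t != 0 -> P t.
Proof. by split=> /nbhs0_ball[e e0 H]; exists e => //; apply/nbhs0_ball; exists e. Qed.

Lemma hol1_near_neq0 F : F \in hol1 -> F 0 != 0 -> \forall t \near (0 : C), F t != 0.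
Proof.
move=> hF F0; have /near_slice :
    \forall p \near (0 : C * C), (F \o fst) p != 0.
  have hc : (fun=> F 0) \o fst \in @holomorphic_at0 R by rewrite -hol1_fst hol1_cst.
  have hF1 : F \o fst \in @holomorphic_at0 R by rewrite -hol1_fst.
  have near_e : \forall t \near (0 : C), t + F 0 != 0.
    apply/nbhs0_ball; exists `|F 0|; first by rewrite normr_gt0.
    by move=> t; apply: contraTneq => /eqP; rewrite addr_eq0 => /eqP ->; rewrite normrN ltxx.
  have := holomorphic_near (rpredB hF1 hc) (subrr _) near_e.
  by apply: filterS => p; rewrite (_ : (F \o fst - _) p = F p.1 - F 0) // subrK.
exact.
Qed.

Lemma hol1_eq0_at0 F : F \in hol1 -> (\forall t \near 0^', F t = 0) -> F 0 = 0.
Proof.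
move=> hF HF; apply/eqP; apply: contraT => F0.
have Fn0 := nbhs_dnbhs (hol1_near_neq0 hF F0).
by have [t [/= -> /eqP]] := filter_ex (filterI HF Fn0).
Qed.

Lemma dnbhs0_rot (P : C -> Prop) (w : C) : w != 0 ->
  (\forall t \near 0^', P t) -> \forall t \near 0^', P (w * t).
Proof.
move=> w0 /dnbhs0_ball[e e0 H]; apply/dnbhs0_ball; have nw0 : 0 < `|w| by rewrite normr_gt0.
exists (e / `|w|); first by rewrite divr_gt0.
move=> t te t0; apply: H; last by rewrite mulf_neq0.
by rewrite normrM mulrC -ltr_pdivlMr.
Qed.

End OneVariable.

(** * Composition, inversion and order of germs *)

Section GermCalculus.
Variable R : realType.
Local Notation C := (CC R).
Local Notation hol := (@holomorphic_at0 R).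
Local Notation hol1 := (@hol1 R).
Implicit Types (f g : C * C -> C) (F G : C -> C).

Lemma holomorphic_comp2 f g g' : f \in hol -> g \in hol -> g' \in hol ->
  g 0 = 0 -> g' 0 = 0 -> (fun p => f (g p, g' p)) \in hol.
Proof.
move=> /asboolP[a Ha] /asboolP[b Hb] /asboolP[b' Hb'] g0 g'0.
apply/asboolP; exists (comp_coef a b b'); apply: (has_expansion_comp Ha Hb Hb').
  by rewrite -(has_expansion0 Hb).
by rewrite -(has_expansion0 Hb').
Qed.

Lemma holomorphic_comp f phi : f \in hol -> holo_map phi -> phi 0 = 0 ->
  f \o phi \in hol.
Proof.
move=> hf [h1 h2] phi0.
have -> : f \o phi = (fun p => f ((fst \o phi) p, (snd \o phi) p)).
  by apply/funext => p /=; case: (phi p).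
by apply: holomorphic_comp2 hf h1 h2 _ _; rewrite /= phi0.
Qed.

Lemma hol1_comp2 f F G : f \in hol -> F \in hol1 -> G \in hol1 ->
  F 0 = 0 -> G 0 = 0 -> (fun t => f (F t, G t)) \in hol1.
Proof.
rewrite !hol1_fst => hf hF hG F0 G0.
exact: (holomorphic_comp2 hf hF hG F0 G0).
Qed.

Lemma hol1_comp F G : F \in hol1 -> G \in hol1 -> G 0 = 0 -> F \o G \in hol1.
Proof.
move=> hF hG G0; have hF' : F \o fst \in hol by rewrite -hol1_fst.
exact: (hol1_comp2 hF' hG (hol1_cst 0) G0 erefl).
Qed.

Lemma hol1_rot F (z : C) : F \in hol1 -> (fun t => F (z * t)) \in hol1.
Proof.
move=> hF; apply: (@hol1_comp F (fun t => z * t) hF); last by rewrite mulr0.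
exact: (rpredM (hol1_cst z) (@hol1_id R)).
Qed.

(** Applied to [(t ^+ m, g t)] with [M = m], this shows that a nonunit of the
    local ring of the curve pulls back to order at least the multiplicity. *)
Lemma has_series_comp2 M N a f c c' F G :
  has_expansion a f -> vanish_below N a -> has_series c F -> has_series c' G ->
  (0 < M)%N -> (forall k, (k < M)%N -> c k = 0) -> (forall k, (k < M)%N -> c' k = 0) ->
  exists2 d, has_series d (fun t => f (F t, G t)) &
    forall k, (k < M * N)%N -> d k = 0.
Proof.
move=> Ha aN /has_series_fst Hc /has_series_fst Hc' M0 cM c'M.
have vM (c0 : nat -> C) : (forall k, (k < M)%N -> c0 k = 0) -> vanish_below M (in_fst c0).
  move=> H i j lt; rewrite /in_fst; case: eqP => // _; apply: H.
  by apply: leq_ltn_trans lt; rewrite leq_addr.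
have c00 := vM _ cM 0%N 0%N M0; have c00' := vM _ c'M 0%N 0%N M0.
have H := has_expansion_comp Ha Hc Hc' c00 c00'.
eexists; first exact: (has_expansion_series H).
by move=> k lt; apply: (vanish_below_comp aN (vM _ cM) (vM _ c'M)); rewrite addn0.
Qed.

Lemma inv1D_series : has_series (fun k => (-1) ^+ k) (fun t : C => (1 + t)^-1).
Proof.
have h0 : 0 < (2^-1 : C) by rewrite invr_gt0 ltr0n.
exists 2^-1, 1; split; [exact: h0| |] => [k|t /ltW t2].
  by rewrite normrX normrN1 expr1n mul1r exprn_ile1 ?half_ge0 ?half_le1.
have t1 : 2^-1 <= `|1 + t|.
  apply: le_trans (lerB_normD _ _); rewrite normr1 lerBrDr -lerBrDl.
  by apply: le_trans t2 _; rewrite lerBrDr [leRHS]splitr mul1r.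
have t0 : 1 + t != 0 by rewrite -normr_gt0; exact: lt_le_trans h0 t1.
apply: (@cvg_geometric_rate _ _ _ 2) => // n.
have -> : (1 + t)^-1 - pser1 (fun k => (-1) ^+ k) t n = (- t) ^+ n / (1 + t).
  have e : pser1 (fun k => (-1) ^+ k) t n * (1 + t) = 1 - (- t) ^+ n.
    elim: n => [|n IH]; first by rewrite /pser1 big_ord0 mul0r expr0 subrr.
    rewrite /pser1 big_ord_recr /= mulrDl [X in X + _]IH exprS.
    by rewrite -exprNn; ring.
  by apply: (mulIf t0); rewrite mulrBl e mulVf // divfK // opprB addrC subrK.
rewrite normrM normfV normrX normrN ler_pM ?exprn_ge0 ?invr_ge0 //.
  by rewrite lerXn2r ?nnegrE ?half_ge0.
rewrite -[leRHS]invrK lef_pV2 ?posrE ?invr_gt0 ?ltr0n //.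
by rewrite (lt_le_trans h0).
Qed.

(** Up to the factor [(f 0)^-1], this is the geometric series evaluated at a function
    vanishing at the origin. *)
Lemma holomorphicV f : f \in hol -> f 0 != 0 -> (fun p => (f p)^-1) \in hol.
Proof.
move=> hf f0; have cst x : (fun=> x) \in hol.
  by have := hol1_cst x; rewrite hol1_fst.
pose g p := (f 0)^-1 * f p - 1.
have hg : g \in hol by exact: (rpredB (rpredM (cst _) hf) (cst 1)).
have g0 : g 0 = 0 by rewrite /g mulVf // subrr.
have hi : (fun t : C => (1 + t)^-1) \o fst \in hol.
  by rewrite -hol1_fst; apply/asboolP; eexists; exact: inv1D_series.
have h := holomorphic_comp2 hi hg (cst 0) g0 erefl.
have -> : (fun p => (f p)^-1) = (fun p => (f 0)^-1 * (1 + g p)^-1).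
  by apply/funext => p; rewrite /g addrC subrK invfM invrK mulrA mulVf // mul1r.
exact: (rpredM (cst _) h).
Qed.

Lemma hol1V F : F \in hol1 -> F 0 != 0 -> (fun t => (F t)^-1) \in hol1.
Proof. by rewrite !hol1_fst => hF F0; exact: (holomorphicV hF F0). Qed.

(** The exponent is the index of the first nonzero coefficient. *)
Lemma hol1_order F : F \in hol1 -> (\forall t \near (0 : C), F t = 0) \/
  exists n G, [/\ G \in hol1, G 0 != 0 & forall t, F t = t ^+ n * G t].
Proof.
move=> /asboolP[c Hc]; have [c0|/existsNP cn0] := pselect (forall k, c k = 0).
  left; have [r [B [r0 _ cF]]] := Hc; apply/nbhs0_ball; exists r => // t /cF cv.
  have cst : pser1 c t @ \oo --> (0 : C).
    apply: cvg_near_cst; exists 0%N => // n _.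
    by rewrite /pser1 big1 // => i _; rewrite c0 mul0r.
  exact: (@norm_cvg_unique _ C _ _ _ _ cv cst).
have ex : exists k, c k != 0 by have [k /eqP] := cn0; exists k.
have cn k : (k < ex_minn ex)%N -> c k = 0.
  by case: ex_minnP => n _ H lt; apply/eqP; apply: contraTT lt => /H; rewrite -leqNgt.
have [G HG FG] := has_series_factor Hc cn.
right; exists (ex_minn ex), G; split; [by apply/asboolP; eexists; exact: HG| |exact: FG].
by rewrite (has_series0 HG) addn0; case: ex_minnP.
Qed.

End GermCalculus.

(** * Traces over the roots of unity *)

Section Trace.
Variable R : realType.
Local Notation C := (CC R).
Local Notation hol := (@holomorphic_at0 R).
Local Notation hol1 := (@hol1 R).
Implicit Types (f g : C * C -> C) (F G : C -> C).

Lemma sum_expr_unity (K : fieldType) (z : K) m j : m.-primitive_root z ->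
  \sum_(k < m) z ^+ (k * j) = if (m %| j)%N then m%:R else 0.
Proof.
move=> pz; rewrite (eq_bigr (fun k : 'I_m => (z ^+ j) ^+ k)); last first.
  by move=> k _; rewrite mulnC exprM.
have <- : (z ^+ j == 1) = (m %| j)%N by rewrite -(prim_order_dvd pz).
case: eqP => [->|/eqP zj].
  by rewrite (eq_bigr (fun=> 1)) ?sumr_const ?card_ord // => k _; exact: expr1n.
apply: (mulfI (x := z ^+ j - 1)); first by rewrite subr_eq0.
by rewrite -subrX1 mulr0 -exprM mulnC exprM (prim_expr_order pz) expr1n subrr.
Qed.

Lemma norm_prim_root_expr (z : C) n k : n.+1.-primitive_root z -> `|z ^+ k| = 1.
Proof.
move=> pz; have zn : `|z| ^+ n.+1 = 1 by rewrite -normrX (prim_expr_order pz) normr1.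
have /eqP z1 : `|z| == 1 by rewrite -(@pexpr_eq1 _ _ n.+1) // zn.
by rewrite normrX z1 expr1n.
Qed.

Lemma pser1_trace (c : nat -> C) (z t : C) n N : n.+1.-primitive_root z ->
  \sum_(k < n.+1) z ^+ k * pser1 c (z ^+ k * t) (N * n.+1) =
  pser1 (fun k => n.+1%:R * c (k * n.+1 + n)%N) (t ^+ n.+1) N * t ^+ n.
Proof.
move=> pz.
have -> : \sum_(k < n.+1) z ^+ k * pser1 c (z ^+ k * t) (N * n.+1) =
   \sum_(i < N * n.+1) (if (n.+1 %| i.+1)%N then n.+1%:R else 0) * (c i * t ^+ i).
  under eq_bigr do rewrite mulr_sumr.
  rewrite exchange_big /=; apply: eq_bigr => i _.
  rewrite -(sum_expr_unity _ pz) mulr_suml; apply: eq_bigr => k _.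
  by rewrite exprMn -exprM (mulnS k i) exprD; ring.
elim: N => [|N IH]; first by rewrite /pser1 !big_ord0 mul0r.
rewrite mulSn addnC big_split_ord /= IH /pser1 [in RHS]big_ord_recr mulrDl.
congr (_ + _); rewrite big_ord_recr /= big1 => [|i _].
  rewrite add0r -addnS -mulSnr dvdn_mull // -exprM -!mulrA -exprD; congr (_ * (_ * _)).
  by rewrite mulnC.
by rewrite -addnS dvdn_addr ?dvdn_mull // gtnNdvd ?mul0r // ltnS.
Qed.

(** Averaging over the rotations by [n.+1]-st roots of unity, with the
    character that keeps the exponents congruent to [n], leaves [t ^+ n] times
    a function of [t ^+ n.+1]. *)
Lemma trace_descends F (z : C) n : F \in hol1 -> n.+1.-primitive_root z ->
  exists2 G, G \in hol1 & \forall t \near 0^',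
    \sum_(k < n.+1) z ^+ k * F (z ^+ k * t) = t ^+ n * G (t ^+ n.+1).
Proof.
move=> /asboolP[c [r [B [r0 cB cF]]]] pz.
pose d k := n.+1%:R * c (k * n.+1 + n)%N.
have z1 k : `|z ^+ k| = 1 by rewrite (norm_prim_root_expr _ pz).
have cv t : `|t| < r -> t != 0 -> pser1 d (t ^+ n.+1) @ \oo -->
    (\sum_(k < n.+1) z ^+ k * F (z ^+ k * t)) / t ^+ n.
  move=> tr t0.
  have -> : pser1 d (t ^+ n.+1) = (fun N =>
      (\sum_(k < n.+1) z ^+ k * pser1 c (z ^+ k * t) (N * n.+1)) / t ^+ n).
    by apply/funext => N; rewrite pser1_trace // mulfK // expf_neq0.
  apply: cvgMr_tmp; apply: cvg_big => [|k _]; first exact: add_continuous.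
  apply: cvgMl_tmp.
  apply: (cvg_reindex (h := fun N => (N * n.+1)%N)); first by move=> N; rewrite leq_pmulr.
  by apply: cF; rewrite normrM z1 mul1r.
(* Convergence at [w] is read off at an [n.+1]-st root [t] of [w], where the
   partial sums are, up to the factor [t ^+ n], those of the averaged function. *)
exists (fun w => lim (pser1 d w @ \oo)).
  apply/asboolP; exists d, (r ^+ n.+1), (n.+1%:R * B / r ^+ n).
  split; [exact: exprn_gt0| |] => [k|w wr].
    rewrite ler_pdivlMr ?exprn_gt0 // normrM normr_nat -!mulrA ler_wpM2l //.
    by rewrite -exprM -exprD mulnC; exact: cB.
  have [w0|w0] := eqVneq w 0.
    have cst : pser1 d 0 @ \oo --> d 0%N.
      by apply: cvg_near_cst; exists 1%N => // -[//|N] _; exact: pser1_0.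
    by rewrite w0; apply/cvg_ex; exists (d 0%N); exact: cst.
  have wE : (n.+1.-root w) ^+ n.+1 = w by rewrite rootCK.
  have t0 : n.+1.-root w != 0.
    by apply: contraNneq w0 => t0; rewrite -wE t0 expr0n.
  have tr : `|n.+1.-root w| < r.
    by rewrite -(@ltr_pXn2r _ n.+1) // ?nnegrE ?(ltW r0) // -normrX wE.
  rewrite -wE; apply/cvg_ex; eexists; exact: cv tr t0.
apply/dnbhs0_ball; exists r => // t tr t0.
have -> := @cvg_lim _ (@norm_hausdorff _ C) _ _ _ _ _ (cv t tr t0).
by rewrite mulrCA mulfV ?mulr1 // expf_neq0.
Qed.

Lemma hol1_sum (I : Type) (r : seq I) (P : pred I) (F : I -> C -> C) :
  (forall i, P i -> F i \in hol1) -> (fun t => \sum_(i <- r | P i) F i t) \in hol1.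
Proof.
move=> hF; have -> : (fun t => \sum_(i <- r | P i) F i t) = \sum_(i <- r | P i) F i.
  by apply/funext => t; rewrite fct_sumE.
exact: rpred_sum.
Qed.

Lemma hol1_near_eq F G : F \in hol1 -> G \in hol1 ->
  (\forall t \near 0^', F t = G t) -> \forall t \near (0 : C), F t = G t.
Proof.
move=> hF hG /dnbhs0_ball[e e0 H]; apply/nbhs0_ball; exists e => // t te.
have [->|t0] := eqVneq t 0; last exact: H.
have HFG : \forall s \near 0^', (F - G) s = 0.
  apply/dnbhs0_ball; exists e => // s se s0.
  by rewrite (_ : (F - G) s = F s - G s) // H // subrr.
have FG0 : F 0 - G 0 = 0 := hol1_eq0_at0 (rpredB hF hG) HFG.
by apply/eqP; rewrite -subr_eq0 FG0.
Qed.

End Trace.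

(** * Lagrange interpolation *)

Section Lagrange.
Variables (K : fieldType) (n : nat) (x : 'I_n.+1 -> K).
Hypothesis x_inj : injective x.

Let L (i : 'I_n.+1) : {poly K} := \prod_(j | j != i) ('X - (x j)%:P).

Let L_enum i : L i = \prod_(j <- enum (predC1 i)) ('X - (x j)%:P).
Proof. by rewrite big_enum. Qed.

Lemma size_lagrange_factor i : size (L i) = n.+1.
Proof. by rewrite L_enum size_prod_XsubC -cardE cardC1 card_ord. Qed.

Lemma horner_lagrange_factor i k : (L i).[x k] =
  if k == i then \prod_(j | j != i) (x i - x j) else 0.
Proof.
rewrite horner_prod; case: eqP => [->|/eqP ki].
  by apply: eq_bigr => j _; rewrite hornerXsubC.
by rewrite (bigD1 k) //= hornerXsubC subrr mul0r.
Qed.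

Lemma lagrange_denom_neq0 i : \prod_(j | j != i) (x i - x j) != 0.
Proof.
by apply/prodf_neq0 => j ji; rewrite subr_eq0 (inj_eq x_inj) eq_sym.
Qed.

Lemma horner_lagrange (y : 'I_n.+1 -> K) k :
  (\sum_i (y i / \prod_(j | j != i) (x i - x j)) *: L i).[x k] = y k.
Proof.
rewrite horner_sum (bigD1 k) //= [X in _ + X]big1 => [|i ik].
  by rewrite addr0 hornerZ horner_lagrange_factor eqxx divfK ?lagrange_denom_neq0.
by rewrite hornerZ horner_lagrange_factor eq_sym (negbTE ik) mulr0.
Qed.

(** Comparing top coefficients in the interpolation formula: every Lagrange
    factor is monic of degree [n]. *)
Lemma coef_lagrange (Q : {poly K}) : (size Q <= n.+1)%N ->
  Q`_n = \sum_i Q.[x i] / \prod_(j | j != i) (x i - x j).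
Proof.
move=> sQ; pose P := \sum_i (Q.[x i] / \prod_(j | j != i) (x i - x j)) *: L i.
have -> : Q = P.
  apply/eqP; rewrite -subr_eq0; apply/eqP.
  apply: (@roots_geq_poly_eq0 _ _ [seq x i | i <- enum 'I_n.+1]).
  - apply/allP => _ /mapP[i _ ->]; rewrite rootE hornerD hornerN horner_lagrange.
    by rewrite subrr.
  - by rewrite map_inj_uniq ?enum_uniq.
  rewrite size_map size_enum_ord (leq_trans (size_polyD _ _)) // size_polyN.
  rewrite geq_max sQ (leq_trans (size_sum _ _ _)) //; apply/bigmax_leqP => i _.
  by rewrite (leq_trans (size_scale_leq _ _)) // size_lagrange_factor.
rewrite coef_sum; apply: eq_bigr => i _; rewrite coefZ.
have -> : (L i)`_n = 1.
  have : L i \is monic by rewrite L_enum monic_prod_XsubC.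
  by move=> /monicP; rewrite lead_coefE size_lagrange_factor.
by rewrite mulr1 horner_lagrange.
Qed.

End Lagrange.

(** * The conductor of the ring of a branch *)

Section Conductor.
Variable R : realType.
Local Notation C := (CC R).
Local Notation hol := (@holomorphic_at0 R).
Local Notation hol1 := (@hol1 R).
Implicit Types (F G : C -> C).

Definition hol1_poly (P : C -> {poly C}) : Prop := forall i, (fun t => (P t)`_i) \in hol1.

Lemma hol1_polyC F : F \in hol1 -> hol1_poly (fun t => (F t)%:P).
Proof.
move=> hF [|i]; first by have -> : (fun t => (F t)%:P`_0) = F
  by apply/funext => t; rewrite coefC.
have -> : (fun t => (F t)%:P`_i.+1) = (fun=> 0) by apply/funext => t; rewrite coefC.
exact: hol1_cst.
Qed.

Lemma hol1_poly_cst (P : {poly C}) : hol1_poly (fun=> P).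
Proof. by move=> i; exact: hol1_cst. Qed.

Lemma hol1_polyB P Q : hol1_poly P -> hol1_poly Q -> hol1_poly (fun t => P t - Q t).
Proof.
move=> hP hQ i; have -> : (fun t => (P t - Q t)`_i) =
  (fun t => (P t)`_i) - (fun t => (Q t)`_i) by apply/funext => t; rewrite coefB.
exact: (rpredB (hP i) (hQ i)).
Qed.

Lemma hol1_polyM P Q : hol1_poly P -> hol1_poly Q -> hol1_poly (fun t => P t * Q t).
Proof.
move=> hP hQ i; have -> : (fun t => (P t * Q t)`_i) =
  (fun t => \sum_(j < i.+1) (P t)`_j * (Q t)`_(i - j)).
  by apply/funext => t; rewrite coefM.
by apply: hol1_sum => j _; exact: (rpredM (hP j) (hQ (i - j)%N)).
Qed.

Lemma hol1_polyZ F P : F \in hol1 -> hol1_poly P -> hol1_poly (fun t => F t *: P t).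
Proof.
move=> hF hP i; have -> : (fun t => (F t *: P t)`_i) = (fun t => F t * (P t)`_i).
  by apply/funext => t; rewrite coefZ.
exact: (rpredM hF (hP i)).
Qed.

Lemma hol1_poly_sum (I : Type) (r : seq I) (A : pred I) (P : I -> C -> {poly C}) :
  (forall i, A i -> hol1_poly (P i)) -> hol1_poly (fun t => \sum_(i <- r | A i) P i t).
Proof.
move=> hP j; have -> : (fun t => (\sum_(i <- r | A i) P i t)`_j) =
  (fun t => \sum_(i <- r | A i) (P i t)`_j) by apply/funext => t; rewrite coef_sum.
by apply: hol1_sum => i /hP; exact.
Qed.

Lemma hol1_poly_prod (I : Type) (r : seq I) (A : pred I) (P : I -> C -> {poly C}) :
  (forall i, A i -> hol1_poly (P i)) -> hol1_poly (fun t => \prod_(i <- r | A i) P i t).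
Proof.
move=> hP; elim: r => [|i r IH].
  have -> : (fun t => \prod_(i <- [::] | A i) P i t) = fun=> 1.
    by apply/funext => t; rewrite big_nil.
  exact: hol1_poly_cst.
have [Ai|nAi] := boolP (A i).
  have -> : (fun t => \prod_(j <- i :: r | A j) P j t) =
     (fun t => P i t * \prod_(j <- r | A j) P j t).
    by apply/funext => t; rewrite big_cons Ai.
  exact: hol1_polyM (hP i Ai) IH.
have -> : (fun t => \prod_(j <- i :: r | A j) P j t) =
   (fun t => \prod_(j <- r | A j) P j t).
  by apply/funext => t; rewrite big_cons (negbTE nAi).
exact: IH.
Qed.

Variables (n : nat) (z : C) (g : C -> C).
Hypothesis z_prim : n.+1.-primitive_root z.
Hypothesis g_hol : g \in hol1.

Definition other_conjugates (t : C) : {poly C} :=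
  \prod_(k : 'I_n.+1 | k != 0) ('X - (g (z ^+ k * t))%:P).

(** The derivative at [g t] of the minimal polynomial of [g] over the series in
    [t ^+ n.+1], that is, the different of the equation of the curve. *)
Definition different (t : C) : C :=
  \prod_(k : 'I_n.+1 | k != 0) (g t - g (z ^+ k * t)).

(** The quantities attached to a conjugate of [g] are those attached to [g],
    evaluated at the rotated parameter. *)
Lemma prod_other_conjugates (A : comNzRingType) (f : C -> A) (i : 'I_n.+1) t :
  \prod_(j : 'I_n.+1 | j != i) f (z ^+ j * t) =
  \prod_(k : 'I_n.+1 | k != 0) f (z ^+ k * (z ^+ i * t)).
Proof.
rewrite (reindex (fun k : 'I_n.+1 => k + i)) /=; last first.
  by exists (fun k => k - i) => k _; rewrite ?addrK ?subrK.
apply: eq_big => [k|k _]; first by rewrite -subr_eq0 addrK.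
by rewrite mulrA -exprD -[in RHS](prim_expr_mod z_prim).
Qed.

Lemma different_ord (i : 'I_n.+1) t : different (z ^+ i * t) =
  \prod_(j : 'I_n.+1 | j != i) (g (z ^+ i * t) - g (z ^+ j * t)).
Proof. by rewrite (prod_other_conjugates (fun s => g (z ^+ i * t) - g s)). Qed.

Lemma other_conjugates_ord (i : 'I_n.+1) t : other_conjugates (z ^+ i * t) =
  \prod_(j : 'I_n.+1 | j != i) ('X - (g (z ^+ j * t))%:P).
Proof. by rewrite (prod_other_conjugates (fun s => 'X - (g s)%:P)). Qed.

Lemma hol1_conj_factor (k : nat) : hol1_poly (fun t => 'X - (g (z ^+ k * t))%:P).
Proof.
apply: hol1_polyB; first exact: hol1_poly_cst.
by apply: hol1_polyC; exact: hol1_rot.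
Qed.

Lemma hol1_other_conjugates : hol1_poly other_conjugates.
Proof. by apply: hol1_poly_prod => k _; exact: hol1_conj_factor. Qed.

Lemma size_other_conjugates t : size (other_conjugates t) = n.+1.
Proof.
have := size_lagrange_factor (fun k : 'I_n.+1 => g (z ^+ k * t)) 0.
by [].
Qed.

Variables (d : nat) (u : C -> C).
Hypothesis conj_inj : \forall t \near 0^',
  injective (fun k : 'I_n.+1 => g (z ^+ k * t)).
Hypotheses (u_hol : u \in hol1) (u0 : u 0 != 0).
Hypothesis differentE : forall t, different t = t ^+ d * u t.

Lemma prim_expr_cancel (k : nat) : z ^+ k * (z ^+ k) ^+ n = 1.
Proof. by rewrite -exprS -exprM mulnC exprM (prim_expr_order z_prim) expr1n. Qed.

Lemma prim_unit_root_neq0 (k : nat) : z ^+ k != 0.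
Proof.
rewrite expf_neq0 //; apply/eqP => z0.
by have /eqP := prim_expr_order z_prim; rewrite z0 expr0n eq_sym oner_eq0.
Qed.

(** Lagrange interpolation at the conjugates of [g] writes a germ of large order
    as a polynomial in [g] whose coefficients are traces of quotients by the
    different; the poles of these quotients have order at most [n], and taking
    the trace removes poles of order at most [n] in [t]. *)
Lemma conductor_contains N F : F \in hol1 -> (d <= n + N)%N -> g 0 = 0 ->
  exists2 h, h \in hol & \forall t \near (0 : C), h (t ^+ n.+1, g t) = t ^+ N * F t.
Proof.
move=> hF dN g0.
(* The coefficient of degree [j] of the interpolation polynomial is the trace of
   [s ^- n * W j s]. Rotating [s] by [z ^+ k] multiplies [s ^- n] by [z ^+ k],
   which is the character in [trace_descends]. *)
pose W j s := s ^+ (n + N - d) * F s * (u s)^-1 * (other_conjugates s)`_j.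
have hW j : W j \in hol1.
  have h1 := rpredM (@hol1_exp R (n + N - d)) hF.
  exact: (rpredM (rpredM h1 (hol1V u_hol u0)) (hol1_other_conjugates j)).
have /choice[G HG] j : exists G, G \in hol1 /\ \forall t \near 0^',
    \sum_(k < n.+1) z ^+ k * W j (z ^+ k * t) = t ^+ n * G (t ^+ n.+1).
  by have [G hG HG] := trace_descends (hW j) z_prim; exists G.
pose h p := \sum_(j < n.+1) G j p.1 * p.2 ^+ j.
have hh : h \in hol.
  have -> : h = \sum_(j < n.+1) ((G j \o fst) * (snd ^+ j)).
    by apply/funext => p; rewrite fct_sumE; apply: eq_bigr => j _; rewrite !fctE.
  apply: rpred_sum => j _; apply: rpredM; first by rewrite -hol1_fst; have [] := HG j.
  by apply: rpredX; exact: holomorphic_snd.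
exists h; first exact: hh.
apply: hol1_near_eq.
- apply: (hol1_comp2 hh (@hol1_exp R n.+1) g_hol _ g0).
  by rewrite expr0n.
- exact: (rpredM (@hol1_exp R N) hF).
have HG' : \forall t \near 0^', forall j : 'I_n.+1,
    \sum_(k < n.+1) z ^+ k * W j (z ^+ k * t) = t ^+ n * G j (t ^+ n.+1).
  by apply: filter_forall => j; have [] := HG j.
have un0 : \forall t \near 0^', forall k : 'I_n.+1, u (z ^+ k * t) != 0.
  apply: filter_forall => k; apply: nbhs_dnbhs; apply: hol1_near_neq0; last by rewrite mulr0.
  exact: hol1_rot.
have tn0 : \forall t \near 0^', t != 0 :> C.
  by apply/dnbhs0_ball; exists 1.
near=> t.
have t0 : t != 0 by near: t.
have inj_t : injective (fun k : 'I_n.+1 => g (z ^+ k * t)) by near: t.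
have HGt : forall j : 'I_n.+1,
  \sum_(k < n.+1) z ^+ k * W j (z ^+ k * t) = t ^+ n * G j (t ^+ n.+1) by near: t.
have ut : forall k : 'I_n.+1, u (z ^+ k * t) != 0 by near: t.
pose phi s := s ^+ N * F s.
pose P : {poly C} := \sum_(i < n.+1)
  (phi (z ^+ i * t) / different (z ^+ i * t)) *: other_conjugates (z ^+ i * t).
have Pg : P.[g t] = phi t.
  have := horner_lagrange inj_t (fun i => phi (z ^+ i * t)) 0.
  rewrite expr0 mul1r => <-; congr (_.[_]); apply: eq_bigr => i _.
  by rewrite different_ord other_conjugates_ord.
rewrite -/(phi t) -Pg.
have sP : (size P <= n.+1)%N.
  rewrite (leq_trans (size_sum _ _ _)) //; apply/bigmax_leqP => i _.
  by rewrite (leq_trans (size_scale_leq _ _)) // size_other_conjugates.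
rewrite (horner_coef_wide _ sP); apply: eq_bigr => j _ /=; congr (_ * _).
apply: (mulfI (expf_neq0 n t0)); rewrite -HGt coef_sum mulr_sumr.
apply: eq_bigr => k _; rewrite coefZ differentE /W /phi.
set s := z ^+ k * t.
have s0 : s != 0 by rewrite mulf_neq0 // prim_unit_root_neq0.
have tE : t ^+ n = z ^+ k * s ^+ n.
  by rewrite /s exprMn mulrA prim_expr_cancel mul1r.
have sE : s ^+ n * s ^+ N = s ^+ (n + N - d) * s ^+ d.
  by rewrite -!exprD subnK.
have sd0 : s ^+ d != 0 by rewrite expf_neq0.
have us0 : u s != 0 by exact: ut.
rewrite tE; transitivity (z ^+ k * ((s ^+ n * s ^+ N) / s ^+ d) * F s * (u s)^-1 * (other_conjugates s)`_j).
  by rewrite sE mulfK //; ring.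
by field; rewrite us0 sd0.
Unshelve. all: by end_near. Qed.

Definition conj_minpoly (t : C) : {poly C} := \prod_(k < n.+1) ('X - (g (z ^+ k * t))%:P).

(** The remainder of ['X ^+ j] modulo [conj_minpoly t]; the recursion makes it
    visible that its coefficients are polynomials in those of
    [conj_minpoly t]. *)
Fixpoint power_rem (j : nat) (t : C) : {poly C} :=
  if j is j'.+1 then 'X * power_rem j' t - (power_rem j' t)`_n *: conj_minpoly t
  else 1.

Lemma hol1_power_rem j : hol1_poly (power_rem j).
Proof.
elim: j => [|j IH]; first exact: hol1_poly_cst.
apply: hol1_polyB; first by apply: hol1_polyM IH; exact: hol1_poly_cst.
apply: hol1_polyZ; first exact: IH.
by apply: hol1_poly_prod => k _; exact: hol1_conj_factor.
Qed.

Lemma size_power_rem j t : (size (power_rem j t) <= n.+1)%N.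
Proof.
have sf : size (conj_minpoly t) = n.+2.
  by rewrite /conj_minpoly size_prod_XsubC -[index_enum _]enumT size_enum_ord.
have f1 : (conj_minpoly t)`_n.+1 = 1.
  have /monicP : conj_minpoly t \is monic by rewrite /conj_minpoly monic_prod_XsubC.
  by rewrite lead_coefE sf.
elim: j => [|j IH] /=; first by rewrite size_poly1.
apply/leq_sizeP => i; rewrite leq_eqVlt => /orP[/eqP <-|lt].
  by rewrite coefB coefXM coefZ f1 mulr1 subrr.
rewrite coefB coefXM coefZ [X in _ * X]nth_default ?sf // mulr0 subr0.
by case: i lt => // i lt; rewrite nth_default // (leq_trans IH).
Qed.

Lemma horner_power_rem j t (k : 'I_n.+1) :
  (power_rem j t).[g (z ^+ k * t)] = g (z ^+ k * t) ^+ j.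
Proof.
elim: j => [|j IH] /=; first by rewrite hornerC expr0.
rewrite hornerD hornerN hornerM hornerX hornerZ IH -exprS.
have -> : (conj_minpoly t).[g (z ^+ k * t)] = 0.
  by rewrite /conj_minpoly horner_prod (bigD1 k) //= hornerXsubC subrr mul0r.
by rewrite mulr0 subr0.
Qed.

(** Subtracting a polynomial leaves terms of degree at least [K] only; on the
    curve they become negligible with respect to [t ^+ N] when [K > N]. *)
Lemma has_expansion_truncate f K : f \in hol -> exists a,
  has_expansion (fun i j => if (i + j < K)%N then 0 else a i j)
    (fun p => f p - \sum_(i < K) \sum_(j < K)
       (if (i + j < K)%N then a i j else 0) * p.1 ^+ i * p.2 ^+ j).
Proof.
move=> /asboolP[a [r [B [r0 aB af]]]]; exists a, r, B.
have B0 : 0 <= B.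
  by apply: le_trans (aB 0%N 0%N); rewrite mulr_ge0 ?exprn_ge0 ?(ltW r0).
split; [exact: r0| |] => [i j|p p1 p2].
  by case: ifP => _; rewrite ?normr0 ?mul0r //; exact: aB.
set a' := fun i j => if (i + j < K)%N then a i j else 0.
set b := fun i j => if (i + j < K)%N then 0 else a i j.
have -> : \sum_(i < K) \sum_(j < K)
   (if (i + j < K)%N then a i j else 0) * p.1 ^+ i * p.2 ^+ j = pser2 a' p K by [].
have a'K N : (K <= N)%N -> pser2 a' p N = pser2 a' p K.
  move=> KN; rewrite /pser2 [in RHS](big_ord_widen N (fun i : nat =>
    \sum_(j < K) a' i j * p.1 ^+ i * p.2 ^+ j)) // [RHS]big_mkcond /=.
  apply: eq_bigr => i _; case: ltnP => iK.
    rewrite [in RHS](big_ord_widen N (fun j : nat => a' i j * p.1 ^+ i * p.2 ^+ j)) //.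
    rewrite [RHS]big_mkcond /=; apply: eq_bigr => j _; case: ltnP => // jK.
    by rewrite /a' ltnNge (leq_trans jK) ?leq_addl //= !mul0r.
  rewrite big1 // => j _.
  by rewrite /a' ltnNge (leq_trans iK) ?leq_addr //= !mul0r.
have abE N : pser2 b p N = pser2 a p N - pser2 a' p N.
  rewrite /pser2 -sumrB; apply: eq_bigr => i _; rewrite -sumrB; apply: eq_bigr => j _.
  by rewrite /a' /b; case: ifP => _; rewrite ?mul0r ?subrr ?subr0.
apply/cvgrPdist_lt => e e0; have /cvgrPdist_lt/(_ e e0)[N _ HN] := af p p1 p2.
exists (N + K)%N => // N' /= NN'.
rewrite abE a'K; last by rewrite (leq_trans _ NN') // leq_addl.
have -> : f p - pser2 a' p K - (pser2 a p N' - pser2 a' p K) = f p - pser2 a p N' by ring.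
by apply: HN => /=; rewrite (leq_trans _ NN') // leq_addr.
Qed.

(** Traces of elements of the ring divided by the different are holomorphic,
    since the top coefficient of an interpolation polynomial is such a trace and
    division by the minimal polynomial of [g] keeps coefficients holomorphic;
    an element of order [d - n.+1] divided by the different has a pole of order
    [n.+1] in [t], which the trace keeps. *)
Lemma conductor_gap N h : h \in hol -> g 0 = 0 -> (N + n.+1)%N = d ->
  ~ \forall t \near 0^', h (t ^+ n.+1, g t) = t ^+ N.
Proof.
move=> hh g0 Nd hN; have [a Ha] := has_expansion_truncate N.+1 hh.
set a' := fun i j => if (i + j < N.+1)%N then a i j else 0.
have [V hV HV] : exists2 V, V \in hol1 & forall t,
    h (t ^+ n.+1, g t) - pser2 a' (t ^+ n.+1, g t) N.+1 = t ^+ N.+1 * V t.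
  have /asboolP[c Hc] : (fun t : C => t ^+ n.+1) \in hol1 by exact: hol1_exp.
  have /asboolP[c' Hc'] := g_hol.
  have c0 k : (k < 1)%N -> c k = 0.
    by case: k => // _; rewrite -(has_series0 Hc) expr0n.
  have c'0 k : (k < 1)%N -> c' k = 0 by case: k => // _; rewrite -(has_series0 Hc').
  have aN : vanish_below N.+1 (fun i j => if (i + j < N.+1)%N then 0 else a i j).
    by move=> i j ->.
  have [b Hb] := has_series_comp2 (M := 1) Ha aN Hc Hc' isT c0 c'0.
  rewrite mul1n => bN; have [V HV VE] := has_series_factor Hb bN.
  by exists V; [apply/asboolP; eexists; exact: HV|exact: VE].
(* On the curve the truncation equals [s ^+ N * (1 - s * V s)]; divided by the
   different it is [s ^- n.+1 * Y s], and [s ^+ n.+1] is invariant by rotation. *)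
pose Y s := (1 - s * V s) * (u s)^-1.
have hY : Y \in hol1.
  apply: rpredM (hol1V u_hol u0).
  exact: (rpredB (hol1_cst 1) (rpredM (@hol1_id R) hV)).
pose P t : {poly C} := \sum_(i < N.+1) \sum_(j < N.+1)
  (a' i j * (t ^+ n.+1) ^+ i) *: power_rem j t.
have hP : hol1_poly P.
  apply: hol1_poly_sum => i _; apply: hol1_poly_sum => j _.
  apply: hol1_polyZ; last exact: hol1_power_rem.
  apply: (rpredM (hol1_cst _)).
  have -> : (fun t : C => (t ^+ n.+1) ^+ i) = (fun t => t ^+ (n.+1 * i)).
    by apply/funext => t; rewrite exprM.
  exact: hol1_exp.
have sP t : (size (P t) <= n.+1)%N.
  rewrite (leq_trans (size_sum _ _ _)) //; apply/bigmax_leqP => i _.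
  rewrite (leq_trans (size_sum _ _ _)) //; apply/bigmax_leqP => j _.
  by rewrite (leq_trans (size_scale_leq _ _)) // size_power_rem.
have Pg t (k : 'I_n.+1) : (P t).[g (z ^+ k * t)] =
    pser2 a' ((z ^+ k * t) ^+ n.+1, g (z ^+ k * t)) N.+1.
  rewrite horner_sum; apply: eq_bigr => i _; rewrite horner_sum.
  apply: eq_bigr => j _; rewrite hornerZ horner_power_rem /=.
  by rewrite [in RHS]exprMn -[in RHS]exprM [(k * _)%N]mulnC [in RHS]exprM
     (prim_expr_order z_prim) expr1n mul1r.
have hS : (fun t => \sum_(k < n.+1) Y (z ^+ k * t)) \in hol1.
  by apply: hol1_sum => k _; exact: hol1_rot.
have hQ : (fun t => t ^+ n.+1 * (P t)`_n) \in hol1.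
  exact: (rpredM (@hol1_exp R n.+1) (hP n)).
(* At the origin the left-hand side vanishes, the right-hand side does not. *)
have : 0 ^+ n.+1 * (P 0)`_n = \sum_(k < n.+1) Y (z ^+ k * 0).
  apply: (nbhs_singleton (hol1_near_eq hQ hS _)).
  have un0 : \forall t \near 0^', forall k : 'I_n.+1, u (z ^+ k * t) != 0.
    apply: filter_forall => k; apply: nbhs_dnbhs; apply: hol1_near_neq0; last by rewrite mulr0.
    exact: hol1_rot.
  have hNk : \forall t \near 0^', forall k : 'I_n.+1,
      h ((z ^+ k * t) ^+ n.+1, g (z ^+ k * t)) = (z ^+ k * t) ^+ N.
    apply: filter_forall => k; exact: (dnbhs0_rot (prim_unit_root_neq0 k) hN).
  have tn0 : \forall t \near 0^', t != 0 :> C.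
    by apply/dnbhs0_ball; exists 1.
  near=> t.
  have t0 : t != 0 by near: t.
  have inj_t : injective (fun k : 'I_n.+1 => g (z ^+ k * t)) by near: t.
  have ut : forall k : 'I_n.+1, u (z ^+ k * t) != 0 by near: t.
  have ht : forall k : 'I_n.+1,
     h ((z ^+ k * t) ^+ n.+1, g (z ^+ k * t)) = (z ^+ k * t) ^+ N by near: t.
  rewrite (coef_lagrange inj_t (sP t)) mulr_sumr; apply: eq_bigr => k _.
  rewrite -different_ord differentE Pg.
  have -> : pser2 a' ((z ^+ k * t) ^+ n.+1, g (z ^+ k * t)) N.+1 =
      (z ^+ k * t) ^+ N * (1 - (z ^+ k * t) * V (z ^+ k * t)).
    apply: (can_inj (subKr ((z ^+ k * t) ^+ N))).
    by rewrite -[X in X - pser2 _ _ _]ht HV exprS; ring.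
  rewrite /Y -Nd exprD.
  have -> : t ^+ n.+1 = (z ^+ k * t) ^+ n.+1.
    by rewrite exprMn -exprM mulnC exprM (prim_expr_order z_prim) expr1n mul1r.
  have s0 : z ^+ k * t != 0 by rewrite mulf_neq0 // prim_unit_root_neq0.
  have sN0 : (z ^+ k * t) ^+ N != 0 by rewrite expf_neq0.
  have sn0 : (z ^+ k * t) ^+ n.+1 != 0 by rewrite expf_neq0.
  have us0 := ut k.
  move: (z ^+ k * t) s0 sN0 sn0 us0 => s s0 sN0 sn0 us0.
  move: (s ^+ N) (s ^+ n.+1) (u s) (V s) sN0 sn0 us0 => A B E W A0 B0 E0.
  by field; rewrite A0 B0 E0.
rewrite expr0n mul0r; under eq_bigr do rewrite mulr0.
rewrite sumr_const card_ord => /esym/eqP.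
rewrite -mulr_natr mulf_eq0 pnatr_eq0 orbF /Y mul0r subr0 mul1r invr_eq0.
by rewrite (negbTE u0).
Unshelve. all: by end_near. Qed.

End Conductor.

(** * The order of the different *)

Section DifferentOrder.
Variable R : realType.
Local Notation C := (CC R).
Local Notation hol1 := (@hol1 R).

(** In characteristic 0 the polynomial ['X^n - 1] is separable, so it has [n]
    distinct roots in the closed field; these form a cyclic group. *)
Lemma prim_root_exists (K : numClosedFieldType) n : (0 < n)%N ->
  exists z : K, n.-primitive_root z.
Proof.
move=> n0; have [r Dp] := closed_field_poly_normal ('X^n - 1 : {poly K}).
rewrite (monicP _) ?monicXnsubC // scale1r in Dp.
have rn1 : all n.-unity_root r by apply/allP => z; rewrite -root_prod_XsubC -Dp.
have sr : (n < (size r).+1)%N by rewrite -(size_prod_XsubC r id) -Dp size_XnsubC.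
have [|z] := hasP (has_prim_root n0 rn1 _ sr); last by exists z.
by rewrite -separable_prod_XsubC -Dp separable_Xn_sub_1 // pnatr_eq0 -lt0n.
Qed.

(** The coefficient of [t ^+ i] in the difference is [c i * (1 - w ^+ i)]. *)
Lemma rot_difference_order (c : nat -> C) (g : C -> C) (w : C) b :
  has_series c g -> `|w| = 1 -> c b != 0 -> w ^+ b != 1 ->
  (forall i, (i < b)%N -> c i != 0 -> w ^+ i = 1) ->
  exists u, [/\ u \in hol1, u 0 != 0 & forall t, g t - g (w * t) = t ^+ b * u t].
Proof.
move=> [r [B [r0 cB cg]]] w1 cb wb H.
have Hs : has_series (fun i => c i * (1 - w ^+ i)) (fun t => g t - g (w * t)).
  exists r, (B * 2); split; [exact: r0| |] => [k|t tr].
    rewrite normrM mulrAC ler_pM ?mulr_ge0 ?exprn_ge0 ?(ltW r0) //.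
    by apply: le_trans (ler_normB _ _) _; rewrite normr1 normrX w1 expr1n.
  have -> : pser1 (fun i => c i * (1 - w ^+ i)) t = pser1 c t - pser1 c (w * t).
    apply/funext => n; rewrite !fctE /pser1 -sumrB; apply: eq_bigr => i _.
    by rewrite exprMn; ring.
  have wtr : `|w * t| < r by rewrite normrM w1 mul1r.
  have /= := cvgB (cg t tr) (cg (w * t) wtr); apply.
have low i : (i < b)%N -> c i * (1 - w ^+ i) = 0.
  move=> ib; have [->|ci] := eqVneq (c i) 0; first by rewrite mul0r.
  by rewrite (H i ib ci) subrr mulr0.
have [u Hu uE] := has_series_factor Hs low; exists u; split; last exact: uE.
  by apply/asboolP; eexists; exact: Hu.
by rewrite (has_series0 Hu) addn0 mulf_neq0 // subr_eq0 eq_sym.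
Qed.

Lemma count_multiples q e : (0 < q)%N -> (\sum_(k < e * q) (q %| k : nat) = e)%N.
Proof.
move=> q0; elim: e => [|e IH]; first by rewrite big_ord0.
rewrite mulSn addnC big_split_ord /= IH; case: q q0 {IH} => // q _.
rewrite big_ord_recl addn0 dvdn_mull // big1 ?addn1 // => i _.
by rewrite dvdn_addr ?dvdn_mull // lift0 gtnNdvd // ltnS.
Qed.

Lemma count_annihilated n e : (e %| n.+1)%N ->
  (\sum_(k < n.+1) (n.+1 %| k * e : nat) = e)%N.
Proof.
move=> /dvdnP[q mE]; have e0 : (0 < e)%N by case: e mE => //; rewrite muln0.
have q0 : (0 < q)%N by case: q mE.
rewrite -[RHS](count_multiples e q0) mulnC -mE.
by apply: eq_bigr => k _; rewrite [X in (X %| _ * _)%N]mE dvdn_pmul2r.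
Qed.

Variables (n M : nat) (c : nat -> C) (e beta : nat -> nat).
Hypothesis chars : puiseux_characteristics n.+1 c M e beta.

Lemma char_dvd j : (1 <= j <= M)%N -> (e j %| e j.-1)%N.
Proof. by move=> jM; have [_ /(_ j jM)[_ ->] _] := chars; exact: dvdn_gcdl. Qed.

Lemma char_dvd0 j : (j <= M)%N -> (e j %| n.+1)%N.
Proof.
have [e0 _ _] := chars; elim: j => [|j IH] jM; first by rewrite e0.
by apply: dvdn_trans (IH (ltnW jM)); exact: (@char_dvd j.+1).
Qed.

Definition different_exponent : nat :=
  \sum_(1 <= j < M.+1) (e j.-1 - e j) * beta j.

(** The [j]-th summand is [beta j] if the [k]-th power of a primitive root of
    unity is an [e j.-1]-st but not an [e j]-th root of unity, and 0 otherwise;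
    there is one such [j] if that power is not 1. *)
Definition conj_order (k : nat) : nat :=
  \sum_(1 <= j < M.+1) ((n.+1 %| k * e j.-1) - (n.+1 %| k * e j)) * beta j.

(** Among the [n.+1]-st roots of unity there are [e j.-1] roots of order dividing
    [e j.-1] and [e j] of order dividing [e j]. *)
Lemma sum_conj_order :
  (\sum_(k < n.+1 | k != ord0) conj_order k)%N = different_exponent.
Proof.
have c0 : conj_order 0 = 0%N.
  by rewrite /conj_order big1 // => j _; rewrite !mul0n dvdn0 subnn.
have -> : (\sum_(k < n.+1 | k != ord0) conj_order k = \sum_(k < n.+1) conj_order k)%N.
  by rewrite [RHS](bigD1 ord0) //= c0.
rewrite /conj_order exchange_big /= big_nat [RHS]big_nat; apply: eq_bigr => j jM.
rewrite ltnS in jM.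
have jM' : (j.-1 <= M)%N by apply: leq_trans (leq_pred _) _; case/andP: jM.
rewrite -big_distrl /= sumnB => [|k _].
  by have [_ jM''] := andP jM; rewrite !count_annihilated ?char_dvd0.
case: (boolP (n.+1 %| k * e j)%N) => // h.
by rewrite (dvdn_trans h) // dvdn_mul // char_dvd.
Qed.

(** A root of unity [z ^+ k] is distinguished by exactly one Puiseux exponent:
    the subgroups of [e j]-th roots of unity decrease to the trivial group. *)
Lemma conj_first_exponent (z : C) (k : 'I_n.+1) : n.+1.-primitive_root z -> k != ord0 ->
  let b := conj_order k in [/\ c b != 0, (z ^+ k) ^+ b != 1 &
    forall i, (i < b)%N -> c i != 0 -> (z ^+ k) ^+ i = 1].
Proof.
move=> pz k0 b; have [e0 ch eM] := chars.
pose P j := (n.+1 %| k * e j)%N.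
have P0 : P 0%N by rewrite /P e0 dvdn_mull.
have nPM : ~~ P M by rewrite /P eM muln1 gtnNdvd // lt0n.
have ex : exists j, ~~ P j by exists M.
pose j := ex_minn ex.
have [nPj Pi] : ~~ P j /\ forall i, (i < j)%N -> P i.
  rewrite /j; case: ex_minnP => j' nP H; split=> // i lt.
  by apply: contraTT lt => /H; rewrite -leqNgt.
have j1 : (0 < j)%N by rewrite lt0n; apply: contraNneq nPj => ->.
have jM : (j <= M)%N by rewrite leqNgt; apply/negP => /Pi; apply/negP.
have Pup i : (i <= M)%N -> (j <= i)%N -> ~~ P i.
  elim: i => [|i IH] iM; first by rewrite leqNgt j1.
  rewrite leq_eqVlt => /orP[/eqP <- //|ji].
  apply: contra (IH (ltnW iM) ji) => h; apply: dvdn_trans h _.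
  by rewrite dvdn_mul // (@char_dvd i.+1).
have bE : b = beta j.
  rewrite /b /conj_order (bigD1_seq j) /=; last by rewrite iota_uniq.
    rewrite -/(P j) -/(P j.-1) (negbTE nPj) Pi ?prednK // subn0 mul1n.
    rewrite big_nat_cond big1 ?addn0 // => i /andP[/andP[i1 iM] ij].
    rewrite -/(P i) -/(P i.-1); have [lt|gt|e'] := ltngtP i j.
    - by rewrite !Pi // (leq_ltn_trans (leq_pred i)).
    - rewrite (negbTE (Pup i _ (ltnW gt))) // (negbTE (Pup i.-1 _ _)) //.
        exact: leq_trans (leq_pred i) _.
      by rewrite -ltnS prednK.
    - by rewrite e' eqxx in ij.
  by rewrite mem_index_iota j1.
have [|[[cb edvd] bmin] ejE] := ch j; first by rewrite j1.
have zdvd i : ((z ^+ k) ^+ i == 1) = (n.+1 %| k * i)%N.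
  by rewrite -exprM -(prim_order_dvd pz).
have Pj1 : P j.-1 by apply: Pi; rewrite prednK.
rewrite bE; split=> //.
  rewrite zdvd; apply: contra nPj => h.
  by rewrite /P ejE muln_gcdr dvdn_gcd h andbT.
move=> i ib ci; apply/eqP; rewrite zdvd.
have : (e j.-1 %| i)%N.
  apply: contraTT ib => edi; rewrite -leqNgt; apply: bmin; split=> //.
by move=> h; apply: dvdn_trans Pj1 _; rewrite dvdn_mul.
Qed.

Lemma different_order (z : C) (g : C -> C) : has_series c g -> n.+1.-primitive_root z ->
  exists u, [/\ u \in hol1, u 0 != 0 &
    forall t, different n z g t = t ^+ different_exponent * u t].
Proof.
move=> cg pz.
have /choice[u Hu] (k : 'I_n.+1) : exists u : C -> C, k != ord0 ->
    [/\ u \in hol1, u 0 != 0 & forall t, g t - g (z ^+ k * t) = t ^+ conj_order k * u t].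
  have [->|k0] := eqVneq k ord0; first by exists 0.
  have [cb wb low] := conj_first_exponent pz k0.
  have [u Hu] := rot_difference_order cg (norm_prim_root_expr k pz) cb wb low.
  by exists u.
exists (fun t => \prod_(k < n.+1 | k != ord0) u k t); split.
- have -> : (fun t => \prod_(k < n.+1 | k != ord0) u k t) = \prod_(k < n.+1 | k != ord0) u k.
    by apply/funext => t; rewrite fct_prodE.
  by apply: rpred_prod => k /Hu[].
- by apply/prodf_neq0 => k /Hu[].
- move=> t; rewrite -sum_conj_order expr_sum -big_split /=.
  by apply: eq_bigr => k /Hu[_ _ ->].
Qed.

End DifferentOrder.

Local Open Scope quotient_scope.

(** * The local ring and its valuation *)

Section Branch.
Variable R : realType.
Local Notation C := (CC R).
Local Notation hol := (@holomorphic_at0 R).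
Local Notation hol1 := (@hol1 R).

(** At half the radius the series converges, so its terms are bounded. *)
Lemma series_has_series (c : nat -> C) (g : C -> C) (r : C) : 0 < r ->
  (forall t, `|t| < r -> series (fun k => c k * t ^+ k) @ \oo --> g t) -> has_series c g.
Proof.
move=> r0 cg.
have pserE t : series (fun k => c k * t ^+ k) = pser1 c t.
  by apply/funext => N; rewrite /series /= big_mkord.
pose s := r / 2; have s0 : 0 < s by rewrite divr_gt0 ?ltr0n.
have sr : s < r by rewrite /s ltr_pdivrMr ?ltr0n // ltr_pMr // ltr1n.
have /cvgrPdist_lt/(_ 1 ltr01)[N _ HN] : pser1 c s @ \oo --> g s.
  by rewrite -pserE; apply: cg; rewrite gtr0_norm.
pose B := 2 + \sum_(i < N) `|c i| * s ^+ i.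
exists s, B; split; [exact: s0| |] => [k|t ts]; last first.
  by rewrite -pserE; apply: cg; exact: lt_trans sr.
have sum0 : 0 <= \sum_(i < N) `|c i| * s ^+ i.
  by apply: sumr_ge0 => i _; rewrite mulr_ge0 ?exprn_ge0 ?(ltW s0).
have [kN|Nk] := ltnP k N.
  rewrite /B (bigD1 (Ordinal kN)) //= addrCA lerDl addr_ge0 //.
  by apply: sumr_ge0 => i _; rewrite mulr_ge0 ?exprn_ge0 ?(ltW s0).
have h1 := HN k Nk; have h2 := HN k.+1 (leqW Nk).
have e : (g s - pser1 c s k) - (g s - pser1 c s k.+1) = c k * s ^+ k.
  by rewrite /pser1 big_ord_recr /=; ring.
rewrite -[s in leLHS]gtr0_norm // -normrX -normrM -e.
apply: le_trans (ler_normB _ _) _; apply: le_trans (lerD (ltW h1) (ltW h2)) _.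
by rewrite -[1 + 1]/(2 : C) lerDl.
Qed.

Lemma hol1_at0_of_order_gt k F G : F \in hol1 -> G \in hol1 ->
  (\forall t \near 0^', t ^+ k * F t = t ^+ k.+1 * G t) -> F 0 = 0.
Proof.
move=> hF hG e; have hFG : F - id * G \in hol1 := rpredB hF (rpredM (@hol1_id R) hG).
have <- : (F - id * G) 0 = F 0 by rewrite -[LHS]/(F 0 - 0 * G 0) mul0r subr0.
apply: (hol1_eq0_at0 hFG).
have tn0 : \forall t \near 0^', t != 0 :> C by apply/dnbhs0_ball; exists 1.
near=> t; have t0 : t != 0 by near: t.
transitivity (F t - t * G t); first by [].
apply: (mulfI (expf_neq0 k t0)); rewrite mulrBr mulr0 mulrA -exprSr.
by apply/eqP; rewrite subr_eq0; apply/eqP; near: t.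
Unshelve. all: by end_near. Qed.

Variables (X : plane_branch R) (n : nat) (c : nat -> C).
Variables (phi psi : C * C -> C * C) (r : C) (g : C -> C).
Hypotheses (phi_holo : holo_map phi) (phi0 : phi 0 = 0).
Hypotheses (psi_holo : holo_map psi) (psi0 : psi 0 = 0).
Hypothesis phiK : \forall p \near (0 : C * C), psi (phi p) = p.
Hypothesis psiK : \forall q \near (0 : C * C), phi (psi q) = q.
Hypotheses (r_gt0 : 0 < r) (g_series : has_series c g).
Hypothesis c_low : forall k, (k < n.+1)%N -> c k = 0.
Hypothesis param_inj : forall s t, `|s| < r -> `|t| < r ->
  (s ^+ n.+1, g s) = (t ^+ n.+1, g t) -> s = t.
Hypothesis branchE : \forall p \near (0 : C * C), branch_set X p <->
  exists t, `|t| < r /\ phi p = (t ^+ n.+1, g t).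

Let A := local_ring X.

Definition normalization (t : C) : C * C := psi (t ^+ n.+1, g t).

Lemma g_at0 : g 0 = 0. Proof. by rewrite (has_series0 g_series) c_low. Qed.

Lemma g_hol1 : g \in hol1. Proof. by apply/asboolP; exists c. Qed.

Lemma normalization0 : normalization 0 = 0.
Proof. by rewrite /normalization expr0n g_at0 -[(_, _)]/(0 : C * C) psi0. Qed.

Lemma hol1_pullback f : f \in hol -> (fun t => f (normalization t)) \in hol1.
Proof.
move=> hf; have hfp := holomorphic_comp hf psi_holo psi0.
apply: (hol1_comp2 hfp (@hol1_exp R n.+1) g_hol1 _ g_at0).
by rewrite expr0n.
Qed.

Lemma near_param (P : C * C -> Prop) : (\forall q \near (0 : C * C), P q) ->
  \forall t \near (0 : C), P (t ^+ n.+1, g t).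
Proof.
apply: (hol1_near2 (@hol1_exp R n.+1) g_hol1 _ g_at0).
by rewrite expr0n.
Qed.

(** Points of the curve close to the origin come from small parameters, because
    their first coordinate is [t ^+ n.+1]. *)
Lemma vanishing_pullback (h : holo_fun R) : h \in vanishing X <->
  \forall t \near (0 : C), h (normalization t) = 0.
Proof.
split=> [/asboolP hX|hT].
  have near_r : \forall t \near (0 : C), `|t| < r by apply/nbhs0_ball; exists r.
  have near_psi P := holo_map_near (P := P) psi_holo psi0.
  have h1 := near_param (near_psi _ hX).
  have h2 := near_param (near_psi _ branchE).
  have h3 := near_param psiK.
  near=> t.
  have h1t : branch_set X (psi (t ^+ n.+1, g t)) -> h (psi (t ^+ n.+1, g t)) = 0 by near: t.
  apply: h1t; have [_ h2t] : branch_set X (psi (t ^+ n.+1, g t)) <-> exists t0, `|t0| < r /\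
     phi (psi (t ^+ n.+1, g t)) = (t0 ^+ n.+1, g t0) by near: t.
  apply: h2t; exists t; split; first by near: t.
  by near: t.
apply/asboolP; have [e e0 he] := proj1 (nbhs0_ball _) hT.
have [phi1 _] := phi_holo.
have near_e : \forall z \near (0 : C), `|z| < e ^+ n.+1.
  by apply/nbhs0_ball; exists (e ^+ n.+1) => //; exact: exprn_gt0.
have h1 := holomorphic_near phi1 (congr1 fst phi0) near_e.
near=> p; move=> Xp.
have [h2 _] : branch_set X p <-> exists t, `|t| < r /\ phi p = (t ^+ n.+1, g t) by near: p.
have [t [tr phip]] := h2 Xp.
have pE : psi (phi p) = p by near: p.
rewrite -pE phip; apply: he.
have : `|(fst \o phi) p| < e ^+ n.+1 by near: p.
by rewrite /= phip /= normrX ltr_pXn2r // nnegrE ltW.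
Unshelve. all: by end_near. Qed.

(** A relation rather than a function, so that the second argument can be any
    convenient representative of the germ. *)
Definition pullback_of (a : A) (F : C -> C) : Prop :=
  \forall t \near (0 : C), repr a (normalization t) = F t.

Lemma pullback_pi (h : holo_fun R) : pullback_of (\pi_A h) (fun t => h (normalization t)).
Proof.
have : h - repr (\pi_A h) \in vanishing X.
  by rewrite Quotient.idealrBE reprK.
move/vanishing_pullback; apply: filterS => t e.
have e' : h (normalization t) - repr (\pi_A h) (normalization t) = 0 := e.
by apply/eqP; rewrite eq_sym -subr_eq0 e'.
Qed.

Lemma pullback_ext a F G : pullback_of a F ->
  (\forall t \near (0 : C), F t = G t) -> pullback_of a G.
Proof. by apply: filterS2 => t -> ->. Qed.

Lemma pullback_ex a : exists2 F, F \in hol1 & pullback_of a F.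
Proof.
exists (fun t => repr a (normalization t)); first exact: hol1_pullback (valP (repr a)).
by near=> t.
Unshelve. all: by end_near. Qed.

Lemma pullback_inj a b F : pullback_of a F -> pullback_of b F -> a = b.
Proof.
move=> aF bF; rewrite -[a]reprK -[b]reprK; apply/eqP.
rewrite -Quotient.idealrBE; apply/vanishing_pullback.
near=> t; have -> : (repr a - repr b : holo_fun R) (normalization t) =
  repr a (normalization t) - repr b (normalization t) by [].
have -> : repr a (normalization t) = F t by near: t.
have -> : repr b (normalization t) = F t by near: t.
exact: subrr.
Unshelve. all: by end_near. Qed.

Lemma pullbackD a b F G : pullback_of a F -> pullback_of b G ->
  pullback_of (a + b) (fun t => F t + G t).
Proof.
move=> aF bG; have := pullback_pi (repr a + repr b).
rewrite rmorphD /= !reprK => h; apply: pullback_ext h _.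
near=> t; transitivity (repr a (normalization t) + repr b (normalization t)); first by [].
by congr (_ + _); near: t.
Unshelve. all: by end_near. Qed.

Lemma pullbackM a b F G : pullback_of a F -> pullback_of b G ->
  pullback_of (a * b) (fun t => F t * G t).
Proof.
move=> aF bG; have := pullback_pi (repr a * repr b).
rewrite rmorphM /= !reprK => h; apply: pullback_ext h _.
near=> t; transitivity (repr a (normalization t) * repr b (normalization t)); first by [].
by congr (_ * _); near: t.
Unshelve. all: by end_near. Qed.

Lemma pullback1 : pullback_of 1 (fun=> 1).
Proof.
have := pullback_pi 1; rewrite rmorph1 => h; apply: pullback_ext h _.
by near=> t.
Unshelve. all: by end_near. Qed.

Lemma pullback0 : pullback_of 0 (fun=> 0).
Proof.
have := pullback_pi 0; rewrite rmorph0 => h; apply: pullback_ext h _.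
by near=> t.
Unshelve. all: by end_near. Qed.

Lemma pullbackX a F k : pullback_of a F -> pullback_of (a ^+ k) (fun t => F t ^+ k).
Proof.
move=> aF; elim: k => [|k IH].
  by rewrite expr0; apply: pullback_ext pullback1 _; near=> t.
by rewrite exprS; apply: pullback_ext (pullbackM aF IH) _; near=> t; rewrite exprS.
Unshelve. all: by end_near. Qed.

Variables (z : C) (d : nat) (u : C -> C).
Hypothesis z_prim : n.+1.-primitive_root z.
Hypotheses (u_hol : u \in hol1) (u0 : u 0 != 0).
Hypothesis differentE : forall t, different n z g t = t ^+ d * u t.

(** The parametrization is injective and rotating the parameter does not change
    its first coordinate, so it must change the second one. *)
Lemma conjugates_inj : \forall t \near 0^', injective (fun k : 'I_n.+1 => g (z ^+ k * t)).
Proof.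
apply/dnbhs0_ball; exists r => // t tr t0 k k' /= gE.
have zt (i : nat) : `|z ^+ i * t| < r by rewrite normrM (norm_prim_root_expr _ z_prim) mul1r.
have powE (i : nat) : (z ^+ i * t) ^+ n.+1 = t ^+ n.+1.
  by rewrite exprMn -exprM mulnC exprM (prim_expr_order z_prim) expr1n mul1r.
have e : ((z ^+ k * t) ^+ n.+1, g (z ^+ k * t)) = ((z ^+ k' * t) ^+ n.+1, g (z ^+ k' * t)).
  by rewrite !powE gE.
have /(mulIf t0)/eqP := param_inj (zt k) (zt k') e.
rewrite (eq_prim_root_expr z_prim) !modn_small ?ltn_ord // => /eqP.
exact: val_inj.
Qed.

Lemma pullback_contains N F : F \in hol1 -> (d <= n + N)%N ->
  exists a, pullback_of a (fun t => t ^+ N * F t).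
Proof.
move=> hF dN.
have [h hh hN] := conductor_contains z_prim g_hol1 conjugates_inj u_hol u0 differentE
  hF dN g_at0.
have hphi : h \o phi \in hol := holomorphic_comp hh phi_holo phi0.
exists (\pi_A (HoloFun hphi)); apply: pullback_ext (pullback_pi _) _.
have psiK' := near_param psiK.
near=> t; rewrite /normalization /=.
have -> : phi (psi (t ^+ n.+1, g t)) = (t ^+ n.+1, g t) by near: t.
by near: t.
Unshelve. all: by end_near. Qed.

Lemma pullback_gap N a F : (N + n.+1)%N = d -> pullback_of a F ->
  ~ \forall t \near 0^', F t = t ^+ N.
Proof.
move=> Nd aF FN; have hpsi := holomorphic_comp (valP (repr a)) psi_holo psi0.
apply: (conductor_gap z_prim g_hol1 conjugates_inj u_hol u0 differentE hpsi g_at0 Nd).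
have aF' : \forall t \near 0^', repr a (normalization t) = F t := nbhs_dnbhs aF.
by move: aF' FN; apply: filterS2 => t <- <-.
Qed.

(** An element of positive order vanishes at the origin, and both coordinates
    [t ^+ n.+1] and [g t] have order at least [n.+1]. *)
Lemma order_ge_branch a k G : pullback_of a (fun t => t ^+ k * G t) ->
  G \in hol1 -> G 0 != 0 -> (0 < k)%N -> (n.+1 <= k)%N.
Proof.
move=> aG hG G0 k0; rewrite leqNgt; apply/negP => kn.
have /asboolP[b Hb] := holomorphic_comp (valP (repr a)) psi_holo psi0.
have b0 : b 0%N 0%N = 0.
  rewrite -(has_expansion0 Hb) /=; have := nbhs_singleton aG.
  by rewrite normalization0 psi0 => ->; rewrite expr0n gtn_eqF // mul0r.
have b_low : vanish_below 1 b by case=> [|i] [|j].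
have tn_low i : (i < n.+1)%N -> (i == n.+1)%:R = 0 :> C by move=> lt; rewrite ltn_eqF.
have [b' Hb' b'_low] := has_series_comp2 Hb b_low (has_series_exp R n.+1) g_series
  (ltn0Sn n) tn_low c_low.
rewrite muln1 in b'_low; have [V HV VE] := has_series_factor Hb' b'_low.
have hV : (fun t => t ^+ (n - k) * V t) \in hol1.
  apply: (rpredM (@hol1_exp R (n - k))).
  by apply/asboolP; eexists; exact: HV.
have aG' : \forall t \near 0^', repr a (normalization t) = t ^+ k * G t := nbhs_dnbhs aG.
have : G 0 = 0.
  apply: (@hol1_at0_of_order_gt k _ _ hG hV); move: aG'; apply: filterS => t <-.
  by rewrite mulrA -exprD addSn subnKC //; exact: VE.
by move/eqP; rewrite (negbTE G0).
Qed.

Lemma pullback_unit a G : pullback_of a G -> G \in hol1 -> G 0 != 0 ->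
  exists b, a * b = 1.
Proof.
move=> aG hG G0; have ra0 : repr a 0 != 0.
  by rewrite -normalization0 (nbhs_singleton aG).
have hV := holomorphicV (valP (repr a)) ra0.
exists (\pi_A (HoloFun hV)).
apply: pullback_inj pullback1; apply: pullback_ext (pullbackM aG (pullback_pi _)) _.
have Gn0 := hol1_near_neq0 hG G0.
near=> t; have Gt : G t != 0 by near: t.
have at_ : repr a (normalization t) = G t by near: t.
by transitivity (G t / repr a (normalization t)); rewrite // at_ mulfV.
Unshelve. all: by end_near. Qed.

Definition ord_ge (a : A) (N : nat) : Prop :=
  exists2 F, F \in hol1 & pullback_of a (fun t => t ^+ N * F t).

Lemma ord_ge0 a : ord_ge a 0.
Proof.
have [F hF aF] := pullback_ex a; exists F => //.
by apply: pullback_ext aF _; near=> t; rewrite expr0 mul1r.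
Unshelve. all: by end_near. Qed.

Lemma ord_ge_zero N : ord_ge 0 N.
Proof.
exists (fun=> 0); first exact: hol1_cst.
by apply: pullback_ext pullback0 _; near=> t; rewrite mulr0.
Unshelve. all: by end_near. Qed.

Lemma ord_geD a b N : ord_ge a N -> ord_ge b N -> ord_ge (a + b) N.
Proof.
move=> [F hF aF] [G hG bG]; exists (F + G); first exact: rpredD hF hG.
by apply: pullback_ext (pullbackD aF bG) _; near=> t; rewrite -mulrDr.
Unshelve. all: by end_near. Qed.

Lemma ord_geM a b N N' : ord_ge a N -> ord_ge b N' -> ord_ge (a * b) (N + N').
Proof.
move=> [F hF aF] [G hG bG]; exists (F * G); first exact: rpredM hF hG.
by apply: pullback_ext (pullbackM aF bG) _; near=> t; rewrite mulrACA -exprD.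
Unshelve. all: by end_near. Qed.

Lemma ord_ge_le a N N' : (N <= N')%N -> ord_ge a N' -> ord_ge a N.
Proof.
move=> NN' [F hF aF]; exists (fun t => t ^+ (N' - N) * F t).
  exact: (rpredM (@hol1_exp R (N' - N)) hF).
by apply: pullback_ext aF _; near=> t; rewrite mulrA -exprD subnKC.
Unshelve. all: by end_near. Qed.

Lemma ord_geX a N k : ord_ge a N -> ord_ge (a ^+ k) (N * k).
Proof.
move=> aN; elim: k => [|k IH]; first by rewrite muln0; exact: ord_ge0.
by rewrite exprS mulnS; exact: ord_geM.
Qed.

Lemma ord_ge_sum (I : Type) (s : seq I) (P : pred I) (a : I -> A) N :
  (forall i, P i -> ord_ge (a i) N) -> ord_ge (\sum_(i <- s | P i) a i) N.
Proof.
move=> H; apply: (big_ind (ord_ge^~ N)) => //; first exact: ord_ge_zero.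
by move=> x y; exact: ord_geD.
Qed.

Lemma ord_ge_prod l (w : 'I_l -> A) N : (forall j, ord_ge (w j) N) ->
  ord_ge (\prod_(j < l) w j) (N * l).
Proof.
elim: l w => [|l IH] w Hw; first by rewrite muln0; exact: ord_ge0.
by rewrite big_ord_recl mulnS; apply: ord_geM (Hw _) _; apply: IH => j; exact: Hw.
Qed.

Lemma ord_ge_ideal_pow (I : set A) N l x : (forall y, I y -> ord_ge y N) ->
  ideal_pow I l x -> ord_ge x (N * l).
Proof.
move=> IN [k [b [v [vI ->]]]]; apply: ord_ge_sum => i _.
rewrite -[(N * l)%N]add0n; apply: ord_geM (ord_ge0 _) _.
by apply: ord_ge_prod => j; exact: IN.
Qed.

Definition ord_eq (a : A) (N : nat) : Prop :=
  exists F, [/\ F \in hol1, F 0 != 0 & pullback_of a (fun t => t ^+ N * F t)].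

Lemma ord_eq_ex a : a = 0 \/ exists N, ord_eq a N.
Proof.
have [F hF aF] := pullback_ex a; have [F0|[N [G [hG G0 FE]]]] := hol1_order hF.
  by left; apply: pullback_inj pullback0; apply: pullback_ext aF F0.
right; exists N, G; split=> //; apply: pullback_ext aF _.
by near=> t; exact: FE.
Unshelve. all: by end_near. Qed.

Lemma ord_eq_ge a N : ord_eq a N -> ord_ge a N.
Proof. by move=> [F [hF _ aF]]; exists F. Qed.

Lemma ord_ge_le_ord_eq a N N' : ord_eq a N -> ord_ge a N' -> (N' <= N)%N.
Proof.
move=> [F [hF F0 aF]] aN'; rewrite leqNgt; apply/negP => lt.
have [G hG aG] := ord_ge_le lt aN'.
have e : \forall t \near 0^', t ^+ N * F t = t ^+ N.+1 * G t.
  by apply: nbhs_dnbhs; move: aF aG; apply: filterS2 => t <- <-.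
by move: F0; rewrite (hol1_at0_of_order_gt hF hG e) eqxx.
Qed.

Lemma ord_eqX a N k : ord_eq a N -> ord_eq (a ^+ k) (N * k).
Proof.
move=> [F [hF F0 aF]]; exists (F ^+ k); split; first by apply: rpredX.
  by rewrite exprfctE expf_neq0.
apply: pullback_ext (pullbackX k aF) _.
by near=> t; rewrite exprfctE exprMn exprM.
Unshelve. all: by end_near. Qed.

Lemma ord_ge_all a : (forall N, ord_ge a N) -> a = 0.
Proof.
move=> H; have [//|[N aN]] := ord_eq_ex a.
by have := ord_ge_le_ord_eq aN (H N.+1); rewrite ltnn.
Qed.

(** The order is a valuation, so an equation of integral dependence over [J]
    bounds the order of its root by the order of [J]. *)
Lemma ord_ge_integral_closure (J : set A) E x : (forall y, J y -> ord_ge y E) ->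
  integral_closure J x -> ord_ge x E.
Proof.
move=> JE [N [b [N1 bJ eqn]]]; have [->|[del xdel]] := ord_eq_ex x.
  exact: ord_ge_zero.
have [Ed|dE] := leqP E del; first exact: ord_ge_le Ed (ord_eq_ge xdel).
have xN : x ^+ N = \sum_(1 <= j < N.+1) (- b j * x ^+ (N - j)).
  by under eq_bigr do rewrite mulNr; rewrite sumrN; apply/eqP; rewrite -addr_eq0 eqn.
have : ord_ge (x ^+ N) (del * N).+1.
  rewrite xN big_nat; apply: ord_ge_sum => j jN.
  have [j1 jN'] := andP jN; rewrite ltnS in jN'.
  apply: (@ord_ge_le _ _ (0 + E * j + del * (N - j))).
    rewrite add0n -{1}(subnKC jN') mulnDr -addSn leq_add2r.
    by rewrite ltn_pmul2r.
  apply: ord_geM; last exact: ord_geX (ord_eq_ge xdel).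
  rewrite -mulN1r; apply: ord_geM (ord_ge0 _) _.
  by apply: ord_ge_ideal_pow JE _; apply: bJ; rewrite j1.
by move/(ord_ge_le_ord_eq (ord_eqX N xdel)); rewrite ltnn.
Qed.

Lemma ideal_pow_gen (I : set A) l a b : I a -> ideal_pow I l (b * a ^+ l).
Proof.
move=> Ia; exists 1%N, (fun=> b), (fun _ _ => a); split=> //.
by rewrite big_ord1 prodr_const card_ord.
Qed.

(** If [a] has minimal order [N] in [I], an element [x] of the closure of
    [I ^ (k + l - 1)] has order at least [N * (k + l - 1)], so [x / a ^+ l] has order
    at least [N * (k - 1)]; as [N >= n.+1], it reaches the conductor and therefore
    lies in the ring. *)
Lemma bs_property_of_conductor k : (d < n.+1 * k)%N -> bs_property A k.
Proof.
move=> dk; have k1 : (1 <= k)%N by rewrite lt0n; apply: contraTneq dk => ->; rewrite muln0.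
split=> // I [I0 ID IM] l l1 x xint.
have E1 : (1 <= k + l - 1)%N by rewrite -addnBA // (leq_trans k1) ?leq_addr.
have xord N : (forall y, I y -> ord_ge y N) -> ord_ge x (N * (k + l - 1)).
  by move=> IN; apply: ord_ge_integral_closure xint => y; exact: ord_ge_ideal_pow.
have [allN|/existsNP[y /not_implyP[Iy yn0]]] := pselect (forall y, I y -> y = 0).
  have -> : x = 0.
    apply: ord_ge_all => N; apply: (@ord_ge_le _ _ (N * (k + l - 1))).
      by rewrite leq_pmulr.
    by apply: xord => y /allN ->; exact: ord_ge_zero.
  by exists 0%N, (fun=> 0), (fun _ _ => 0); split=> [[]//|]; rewrite big_ord0.
have ex : exists N, `[< exists2 a, I a & ord_eq a N >].
  have [//|[N yN]] := ord_eq_ex y.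
  by exists N; apply/asboolP; exists y.
case: (ex_minnP ex) => N /asboolP[a Ia aN] Nmin.
have IN y' : I y' -> ord_ge y' N.
  move=> Iy'; have [->|[N' yN']] := ord_eq_ex y'; first exact: ord_ge_zero.
  apply: ord_ge_le (ord_eq_ge yN'); apply: Nmin; apply/asboolP; by exists y'.
have [F hF xF] := xord _ IN; have [al [hal al0 aal]] := aN.
have [N0|Npos] := posnP N.
  have aal' : pullback_of a al.
    by apply: pullback_ext aal _; near=> t; rewrite N0 expr0 mul1r.
  have [b ab1] := pullback_unit aal' hal al0.
  have -> : x = (x * b ^+ l) * a ^+ l.
    by rewrite -mulrA -exprMn [b * a]mulrC ab1 expr1n mulr1.
  exact: ideal_pow_gen.
have nN := order_ge_branch aal hal al0 Npos.
have hq : (fun t => F t / (al t) ^+ l) \in hol1.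
  have hl : (fun t => (al t) ^+ l) \in hol1.
    by have -> : (fun t => (al t) ^+ l) = al ^+ l; [rewrite exprfctE|apply: rpredX].
  exact: (rpredM hF (hol1V hl (expf_neq0 l al0))).
have [|b bq] := pullback_contains (N := N * (k - 1)) hq.
  have : (n.+1 * (k - 1) <= N * (k - 1))%N by rewrite leq_mul2r nN orbT.
  move=> h; rewrite -ltnS -addSn (leq_trans dk) //.
  by apply: leq_trans (leq_add (leqnn n.+1) h); rewrite -mulnS subn1 prednK.
have -> : x = b * a ^+ l.
  apply: pullback_inj (pullbackM bq (pullbackX l aal)); apply: pullback_ext xF _.
  have aln0 := hol1_near_neq0 hal al0.
  near=> t; have alt0 : (al t) ^+ l != 0 by apply: expf_neq0; near: t.
  have -> : (N * (k + l - 1) = N * (k - 1) + N * l)%N by rewrite -mulnDr addnBAC.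
  by rewrite exprMn -exprM exprD; field.
exact: ideal_pow_gen.
Unshelve. all: by end_near. Qed.

(** The ideal [I] is generated by the first coordinate [Z], which pulls back to
    [t ^+ n.+1]. The element [x] pulling back to [t ^+ d] satisfies
    [x ^+ n.+1 = Z ^+ d], so it is integral over the [k]-th power of [I] when
    [n.+1 * k <= d]; but [x / Z] would pull back to [t ^+ (d - n.+1)], the exponent
    just below the conductor. *)
Lemma conductor_of_bs_property k : bs_property A k -> (d < n.+1 * k)%N.
Proof.
move=> [k1 bsk]; rewrite ltnNge; apply/negP => mkd.
have hfst := proj1 phi_holo.
pose Z : A := \pi_A (HoloFun hfst).
have Zt : pullback_of Z (fun t => t ^+ n.+1).
  apply: pullback_ext (pullback_pi _) _; have psiK' := near_param psiK.
  near=> t; rewrite /normalization /=.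
  have -> // : phi (psi (t ^+ n.+1, g t)) = (t ^+ n.+1, g t) by near: t.
have [x xd] := pullback_contains (N := d) (hol1_cst 1) (leq_addl _ _).
have xZ : x ^+ n.+1 = Z ^+ d.
  apply: pullback_inj (pullbackX d Zt); apply: pullback_ext (pullbackX n.+1 xd) _.
  by near=> t; rewrite mulr1 -!exprM mulnC.
pose I : set A := [set y | exists w, y = w * Z].
have Iideal : is_ideal I.
  split; first by exists 0; rewrite mul0r.
    by move=> _ _ [w ->] [w' ->]; exists (w + w'); rewrite mulrDl.
  by move=> a _ [w ->]; exists (a * w); rewrite mulrA.
have IZ : I Z by exists 1; rewrite mul1r.
have xint : integral_closure (ideal_pow I (k + 1 - 1)) x.
  exists n.+1, (fun j => if j == n.+1 then - Z ^+ d else 0); split=> // [j jn|].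
    case: eqP => [->|_]; last first.
      by exists 0%N, (fun=> 0), (fun _ _ => 0); split=> [[]//|]; rewrite big_ord0.
    have -> : - Z ^+ d = - Z ^+ (d - n.+1 * k) * (Z ^+ k) ^+ n.+1.
      by rewrite mulNr -exprM -exprD [(k * _)%N]mulnC subnK.
    apply: ideal_pow_gen; rewrite addnK -[Z ^+ k]mul1r; exact: ideal_pow_gen.
  rewrite big_nat_recr //= eqxx subnn expr0 mulr1 big_nat_cond big1 => [|j].
    by rewrite add0r xZ subrr.
  by move=> /andP[/andP[_ jn] _]; rewrite ltn_eqF // mul0r.
have [k' [b [v [vI xE]]]] := bsk I Iideal 1%N isT x xint.
have [w xw] : I x.
  rewrite xE; have [I0 ID IM] := Iideal.
  by apply: (big_ind I) => // i _; rewrite big_ord1; apply: IM.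
have [F hF wF] := pullback_ex w.
have nd : (n.+1 <= d)%N by apply: leq_trans mkd; rewrite leq_pmulr.
have tn0 : \forall t \near 0^', t != 0 :> C by apply/dnbhs0_ball; exists 1.
apply: (pullback_gap (subnK nd) wF).
have wZ := pullbackM wF Zt; rewrite -xw in wZ.
have e : \forall t \near 0^', F t * t ^+ n.+1 = t ^+ d * 1.
  by apply: nbhs_dnbhs; move: wZ xd; apply: filterS2 => t <- <-.
near=> t; have t0 : t ^+ n.+1 != 0 by apply: expf_neq0; near: t.
apply: (mulIf t0); rewrite -exprD subnK //.
by rewrite -[RHS]mulr1; near: t.
Unshelve. all: by end_near. Qed.

End Branch.

(** * The Briancon-Skoda number *)

Lemma bs_eq_min (A : comNzRingType) (k : nat) : bs_property A k ->
  (forall k', bs_property A k' -> (k <= k')%N) -> bs A = (k%:Z)%:E.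
Proof.
move=> bsk kmin; rewrite /bs; case: pselect => [ex|[]]; last first.
  by exists k; apply/asboolP.
congr (_%:Z%:E); case: ex_minnP => k' /asboolP bsk' k'min.
by apply/eqP; rewrite eqn_leq kmin // k'min //; apply/asboolP.
Qed.

Lemma ceil_ratio (n d k : nat) : (d < n.+1 * k)%N ->
  (forall k', (d < n.+1 * k')%N -> (k <= k')%N) ->
  Num.ceil ((1 + d%:R) / n.+1%:R : rat) = k%:Z.
Proof.
move=> dk kmin; have k1 : (0 < k)%N by case: k dk {kmin}; rewrite ?muln0.
have m0 : 0 < n.+1%:R :> rat by rewrite ltr0n.
have -> : 1 + d%:R = d.+1%:R :> rat by rewrite -natr1 addrC.
have kE : (k%:Z - 1)%:~R = k.-1%:R :> rat.
  by rewrite -[in LHS](prednK k1) -addn1 PoszD addrK.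
apply: ceil_def; rewrite kE ltr_pdivlMr // ler_pdivrMr // -pmulrn -!natrM.
rewrite ltr_nat ler_nat ltnS mulnC [(k * _)%N]mulnC dk andbT.
rewrite leqNgt; apply/negP => /kmin.
by rewrite leqNgt prednK ?leqnn.
Qed.

Theorem theorem1p1 (R : realType) (X : plane_branch R) (m : nat)
  (c : nat -> CC R) (M : nat) (e beta : nat -> nat) :
  multiplicity X m ->
  puiseux_parametrization X m c ->
  puiseux_characteristics m c M e beta ->
  bs (local_ring X) =
    (Num.ceil ((1 + \sum_(1 <= i < M.+1)
       ((e i.-1)%:R - (e i)%:R) * (beta i)%:R) / m%:R : rat))%:E.
Proof.
move=> _ [phi [r [g [[phi_holo phi0 [psi [psi_holo psi0 phiK psiK]]] [r0 cg] c_low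
  param_inj branchE]]]] chars.
have m0 : (0 < m)%N.
  have [par _] := nbhs_singleton branchE; have [t [_]] := par (branch0 X).
  rewrite phi0 lt0n => /(congr1 fst) /= tm0.
  by apply: contraNneq (oner_neq0 (CC R)) => m0; rewrite -[1](expr0 t) -m0 -tm0.
case: m m0 c_low param_inj branchE chars => // n _ c_low param_inj branchE chars.
have gs := series_has_series r0 cg.
have [z pz] := prim_root_exists (CC R) (ltn0Sn n).
have [u [u_hol u0 uE]] := different_order chars gs pz.
pose d := different_exponent M e beta.
have bsP k : bs_property (local_ring X) k <-> (d < n.+1 * k)%N.
  split.
    exact: (conductor_of_bs_property phi_holo phi0 psi_holo psi0 phiK psiK r0 gs c_low
      param_inj branchE pz u_hol u0 uE).
  exact: (bs_property_of_conductor phi_holo phi0 psi_holo psi0 phiK psiK r0 gs c_low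
      param_inj branchE pz u_hol u0 uE).
have -> : \sum_(1 <= i < M.+1) ((e i.-1)%:R - (e i)%:R) * (beta i)%:R = d%:R :> rat.
  rewrite /d /different_exponent natr_sum [LHS]big_nat [RHS]big_nat; apply: eq_bigr => j jM.
  rewrite ltnS in jM; rewrite natrM natrB // dvdn_leq ?(char_dvd chars) //.
  apply: dvdn_gt0 (char_dvd0 chars _) => //; apply: leq_trans (leq_pred _) _.
  by case/andP: jM.
have ex : exists k, (d < n.+1 * k)%N by exists d.+1; rewrite mulSn ltn_addr.
case: (ex_minnP ex) => k dk kmin.
rewrite (ceil_ratio dk kmin); apply: bs_eq_min; first exact/bsP.
by move=> k' /bsP; exact: kmin.
Qed.
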